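(* Let $\alpha\in(0,1/2]$ and consider the model D-EX-t$(\zeta_n)$ described in the context with $\lim_{n\to\infty}\zeta_n=1$. The set of largest crossing points is $C_1=\{0\}\cup(t_2,\alpha/2)$ and \[ \operatorname{EER}_\infty(1)=\frac{t_2\,F_{\chi_\nu}(\sqrt\nu\,s(t_2\mid1))}{\alpha}+\int_{t_2/\alpha}^{1}F_{\chi_\nu}\big(\sqrt\nu\,s(\alpha t\mid1)\big)dt,\qquad \operatorname{FDR}_\infty(1)=F_{\chi_\nu}\big(\sqrt\nu\,s(t_2\mid1)\big). \]
   Context: Model D-EX-t$(\zeta_n)$: fix $\nu>0$. Let $X_1,\dots,X_n$ be independent with $X_i\sim N(\vartheta_i,1)$ and $S>0$ with $\nu S^2\sim\chi^2_\nu$ independent of the $X_i$; $F_{\chi_\nu}$ is the c.d.f. of $\sqrt\nu S$ (with $F_{\chi_\nu}(x)=0$ for $x\le0$). $\Phi$ is the standard normal c.d.f., $F_{t_\nu}$ the central $t_\nu$ c.d.f. For $H_i:\vartheta_i=0$ vs $K_i:\vartheta_i>0$, $p_i=1-F_{t_\nu}(X_i/S)$; $\vartheta_i=\infty$ is allowed and gives $p_i=0$ a.s. For each $n$, exactly $n_0$ hypotheses are true, $\zeta_n=n_0/n$, the rest have $\vartheta_i=\infty$. LSU at level $\alpha$ rejects all $H_i$ with $p_i\le m\alpha/n$, $m=\max\{i:p_{i:n}\le i\alpha/n\}$. $V_n$ = number of rejected true hypotheses, $R_n$ = number of rejections, $\operatorname{EER}_\infty(1)=\lim_n\mathbb E[V_n/n]$,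 $\operatorname{FDR}_\infty(1)=\lim_n\mathbb E[V_n/(R_n\vee1)]$. Given $S=s$, $F_\infty(t\mid s)=1-\Phi(sF_{t_\nu}^{-1}(1-t))$; $F_\infty(t\mid s)=t/\alpha$ iff $s=s(t\mid1):=\Phi^{-1}(1-t/\alpha)/F_{t_\nu}^{-1}(1-t)$. $t(s\mid1)=\sup\{t\in[0,\alpha]:F_\infty(t\mid s)=t/\alpha\}$, called a largest crossing point (LCP) when $F_\infty(\cdot\mid s)$ lies above $t/\alpha$ just to its left and below just to its right; $C_1$ is the set of LCPs. $t_2$ denotes the (existing) tangent point: there is $s^*>0$ such that with $u=F_{t_\nu}^{-1}(1-t_2)$, $\alpha\Phi(-s^*u)=F_{t_\nu}(-u)$ and $s^*\alpha\varphi(s^*u)=f_{t_\nu}(u)$, i.e. $F_\infty(\cdot\mid s^* )$ touches the line $t\mapsto t/\alpha$ at $t_2$; here $\varphi$ is the standard normal density and $f_{t_\nu}$ the $t_\nu$ density. *)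

(* Defs.v *)
From HB Require Import structures.
From mathcomp Require Import all_boot all_order all_algebra.
From mathcomp Require Import all_classical all_reals all_analysis.
Set Implicit Arguments. Unset Strict Implicit. Unset Printing Implicit Defensive.
Import Order.TTheory GRing.Theory Num.Theory.
Import numFieldNormedType.Exports.
Local Open Scope classical_set_scope.
Local Open Scope ring_scope.

Section Defs.
Variable R : realType.

Definition dens_mass (g : R -> R) : R := \int[@lebesgue_measure R]_y g y.
Definition cdf_of (g : R -> R) (x : R) : R :=
  (\int[@lebesgue_measure R]_(y in `]-oo, x]) g y) / dens_mass g.
Definition pdf_of (g : R -> R) (x : R) : R := g x / dens_mass g.

Definition gauss_kernel (y : R) : R := expR (- (y ^+ 2) / 2).
Definition Phi : R -> R := cdf_of gauss_kernel.
Definition phi : R -> R := pdf_of gauss_kernel.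

Definition t_kernel (nu : R) (y : R) : R := (1 + y ^+ 2 / nu) `^ (- ((nu + 1) / 2)).
Definition F_t (nu : R) : R -> R := cdf_of (t_kernel nu).
Definition f_t (nu : R) : R -> R := pdf_of (t_kernel nu).

Definition chisq_kernel (nu : R) (y : R) : R :=
  if 0 < y then y `^ (nu / 2 - 1) * expR (- y / 2) else 0.
Definition F_chisq (nu : R) : R -> R := cdf_of (chisq_kernel nu).
(* F_{chi_nu}: c.d.f. of sqrt(nu) S when nu S^2 ~ chi^2_nu, S > 0;
   F_{chi_nu}(x) = 0 for x <= 0 *)
Definition F_chi (nu : R) (x : R) : R := if 0 < x then F_chisq nu (x ^+ 2) else 0.

Definition quantile (F : R -> R) (u : R) : R := inf [set x | u <= F x].

Definition F_inf (nu t s : R) : R :=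
  if t <= 0 then 0 else if 1 <= t then 1
  else 1 - Phi (s * quantile (F_t nu) (1 - t)).

Definition s_one (nu alpha t : R) : R :=
  quantile Phi (1 - t / alpha) / quantile (F_t nu) (1 - t).

Definition t_one (nu alpha s : R) : R :=
  sup [set t | 0 <= t <= alpha /\ F_inf nu t s = t / alpha].

Definition is_LCP (nu alpha s : R) : Prop :=
  let t := t_one nu alpha s in
  (exists2 e : R, 0 < e & forall u, t - e < u < t -> F_inf nu u s > u / alpha) /\
  (exists2 e : R, 0 < e & forall u, t < u < t + e -> F_inf nu u s < u / alpha).

Definition C_one (nu alpha : R) : set R :=
  [set t | exists2 s : R, 0 < s & is_LCP nu alpha s /\ t = t_one nu alpha s].

Definition is_tangent_point (nu alpha t2 : R) : Prop :=
  0 < t2 <= alpha /\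
  exists2 sst : R, 0 < sst &
    let u := quantile (F_t nu) (1 - t2) in
    alpha * Phi (- (sst * u)) = F_t nu (- u) /\
    sst * alpha * phi (sst * u) = f_t nu u.

(* i-th order statistic p_{i:n}, i = 1..n *)
Definition ord_stat (n : nat) (p : 'I_n -> R) (i : nat) : R :=
  nth 0 (sort <=%R [seq p j | j <- enum 'I_n]) i.-1.
Definition LSU_m (alpha : R) (n : nat) (p : 'I_n -> R) : nat :=
  \max_(i < n.+1 | (0 < (i : nat))%N && (ord_stat p i <= (i : nat)%:R * alpha / n%:R)) (i : nat).
Definition LSU_rej (alpha : R) (n : nat) (p : 'I_n -> R) : {set 'I_n} :=
  [set i | (0 < LSU_m alpha p)%N && (p i <= (LSU_m alpha p)%:R * alpha / n%:R)].

Section Model.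
Context d (T : measurableType d) (P : probability T R).

(* p-values: true hypotheses p_i = 1 - F_t(X_i/S); false ones (theta_i = oo) p_i = 0 *)
Definition pval (nu : R) (n : nat) (Tn : {set 'I_n}) (X : 'I_n -> T -> R)
  (S : T -> R) (w : T) (i : 'I_n) : R :=
  if i \in Tn then 1 - F_t nu (X i w / S w) else 0.

Definition R_n (alpha nu : R) (n : nat) (Tn : {set 'I_n}) (X : 'I_n -> T -> R) (S : T -> R) (w : T) : nat := #|LSU_rej alpha (pval nu Tn X S w)|.
Definition V_n (alpha nu : R) (n : nat) (Tn : {set 'I_n}) (X : 'I_n -> T -> R) (S : T -> R) (w : T) : nat :=
  #|LSU_rej alpha (pval nu Tn X S w) :&: Tn|.

Definition EER_n (alpha nu : R) (n : nat) (Tn : {set 'I_n}) (X : 'I_n -> T -> R) (S : T -> R) : R :=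
  \int[P]_w ((V_n alpha nu Tn X S w)%:R / n%:R).
Definition FDR_n (alpha nu : R) (n : nat) (Tn : {set 'I_n}) (X : 'I_n -> T -> R) (S : T -> R) : R :=
  \int[P]_w ((V_n alpha nu Tn X S w)%:R / (maxn (R_n alpha nu Tn X S w) 1)%:R).

Definition model_n (nu : R) (n : nat) (Tn : {set 'I_n}) (X : 'I_n -> T -> R)
  (S : T -> R) : Prop :=
  (forall i, measurable_fun setT (X i)) /\ measurable_fun setT S /\
      (forall i, i \in Tn -> forall x : R, P (X i @^-1` `]-oo, x]) = (Phi x)%:E) /\
      P [set w | 0 < S w] = 1%E /\
      (forall x : R, P [set w | nu * S w ^+ 2 <= x] = (F_chisq nu x)%:E) /\
      (forall (B : 'I_n -> set R) (BS : set R),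
         (forall i, measurable (B i)) -> measurable BS ->
         fine (P [set w | (forall i, i \in Tn -> B i (X i w)) /\ BS (S w)]) =
         (\prod_(i in Tn) fine (P (X i @^-1` B i))) * fine (P (S @^-1` BS))).
End Model.

End Defs.

(* Main.v *)
Require Import Defs.
From HB Require Import structures.
From mathcomp Require Import all_boot all_order all_algebra.
From mathcomp Require Import all_classical all_reals all_analysis.
From mathcomp Require Import measurable_realfun ring lra.
Import Order.TTheory GRing.Theory Num.Theory.
Import numFieldNormedType.Exports.
Local Open Scope classical_set_scope.
Local Open Scope ring_scope.
Set Implicit Arguments.
Unset Strict Implicit.
Unset Printing Implicit Defensive.

(** Write [t = F_t (- u)] and [gap s u = alpha * Phi (- s u) - F_t (- u)], so that
    [F_inf (t | s) - t / alpha = gap s u / alpha].  The logarithm of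
    [f_t u / phi (s u)] is strictly convex in [u ^ 2], hence the derivative of
    [gap s] is nonpositive on an interval only: as [u] grows from [0], [gap s]
    increases, then decreases, then increases again to its limit [0].  A tangency at
    [u2] for [s = s*] is therefore the top of the hill: [gap s < 0] when [s > s*],
    and when [s < s*] there is exactly one sign change on [0, u2], the largest
    crossing point.  This gives [C_1].

    The limits need no conditioning on [S].  The counts [#{i : X_i >= c}]
    concentrate around [n Phi (- c)], uniformly in [c], by Chebyshev's inequality on
    a finite grid, and [p_i <= F_t (- u)] reads [S u <= X_i], which is monotone in
    [S].  Hence the event [V_n / n > x] asymptotically coincides with [S < s*] if
    [x < t2 / alpha] and with [S < s (alpha x | 1)] if [x > t2 / alpha]; the layer
    cake formula and dominated convergence give the expected error rate.  For the
    false discovery rate, [V_n / (R_n v 1)] tends to [1] on [S < s*]; on [S > s*] it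
    tends to [0], because the rejection threshold tends to [0] and the Gaussian tail
    [Phi (- s u)] is at most a constant times [F_t (- u) ^ 2]. *)

(** * Distributions with a continuous, positive and even density *)

(** The class shared by the Gaussian and the Student kernel. The condition [dens_mass g != 0] stands
    for integrability. *)
Definition symmetric_density (R : realType) (g : R -> R) : Prop :=
  [/\ continuous g, forall x, 0 < g x, forall x, g (- x) = g x & dens_mass g != 0].

Section SymmetricDensity.
Variables (R : realType) (g : R -> R).
Notation mu := (@lebesgue_measure R).

(** A real-valued integral is [fine] of the extended one, so an infinite mass would read as [0]; a
    nonzero mass is therefore a finite one. *)
Lemma integrable_of_mass : (forall x, 0 <= g x) -> measurable_fun setT g ->
  dens_mass g != 0 -> mu.-integrable setT (EFin \o g).
Proof.
move=> g0 mg gm; apply/integrableP; split; first exact/measurable_EFinP.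
under eq_integral do rewrite /= ger0_norm//.
move: gm; rewrite /dens_mass /Rintegral; case: integral => [r _|/=|/=]; first by rewrite ltry.
all: by rewrite eqxx.
Qed.

Lemma dens_mass_gt0 : (forall x, 0 <= g x) -> dens_mass g != 0 -> 0 < dens_mass g.
Proof. by move=> g0 gm; rewrite lt_neqAle eq_sym gm/= Rintegral_ge0. Qed.

(** Continuity is asked for at the single point [x], because the chi-square kernel may jump at
    [0]. *)
Lemma cdf_of_is_derive x : (forall x, 0 <= g x) -> measurable_fun setT g ->
  dens_mass g != 0 -> {for x, continuous g} -> is_derive x 1 (cdf_of g) (pdf_of g x).
Proof.
move=> g0 mg gm gx.
have gi := integrable_of_mass g0 mg gm.
have gi1 : mu.-integrable [set` Interval -oo%O (BRight (x + 1))] (EFin \o g).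
  by apply: integrableS gi => //.
have xx1 : x < x + 1 by rewrite ltrDl.
have [d1 d2] := continuous_FTC1 xx1 gi1 (ltNyr x) gx.
have : is_derive x 1 (fun x : R => \int[mu]_(t in [set` Interval -oo%O (BRight x)]) g t) (g x).
  by apply: DeriveDef; [exact: d1|rewrite -derive1E; exact: d2].
move=> h; rewrite /cdf_of /pdf_of.
rewrite (_ : (fun _ : R => _) = (dens_mass g)^-1 \*: (fun x : R => \int[mu]_(t in [set` Interval -oo%O (BRight x)]) g t)).
  by rewrite (mulrC (g x)); apply: is_deriveZ.
by apply/funext => y /=; rewrite /GRing.scale/= mulrC.
Qed.

Hypothesis gS : symmetric_density g.

Let gc : continuous g. Proof. by case: gS. Qed.
Let g0 x : 0 < g x. Proof. by case: gS. Qed.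
Let gN x : g (- x) = g x. Proof. by case: gS. Qed.
Let gm : dens_mass g != 0. Proof. by case: gS. Qed.
Let g_ge0 x : 0 <= g x. Proof. exact: ltW. Qed.
Let mg : measurable_fun setT g. Proof. exact: continuous_measurable_fun. Qed.
Let gi : mu.-integrable setT (EFin \o g). Proof. exact: integrable_of_mass. Qed.
Let m0 : 0 < dens_mass g. Proof. exact: dens_mass_gt0. Qed.
Let F := cdf_of g.

Lemma sym_pdf_gt0 x : 0 < pdf_of g x.
Proof. exact: divr_gt0. Qed.

Lemma sym_pdfN x : pdf_of g (- x) = pdf_of g x.
Proof. by rewrite /pdf_of gN. Qed.

Lemma sym_cdf_is_derive (x : R) : is_derive x 1 F (pdf_of g x).
Proof. by apply: cdf_of_is_derive => //; exact: gc. Qed.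

Lemma sym_cdf_continuous : continuous F.
Proof.
by move=> x; apply/differentiable_continuous/derivable1_diffP; case: (sym_cdf_is_derive x).
Qed.

Lemma sym_cdf_lt x y : x < y -> F x < F y.
Proof.
move=> xy; have [c _ /eqP] := MVT xy (fun z _ => sym_cdf_is_derive z)
  (continuous_subspaceT sym_cdf_continuous).
by rewrite subr_eq => /eqP ->; rewrite ltrDr mulr_gt0 ?sym_pdf_gt0 ?subr_gt0.
Qed.

Lemma sym_cdf_le x y : x <= y -> F x <= F y.
Proof. by rewrite le_eqVlt => /predU1P[->//|/sym_cdf_lt/ltW]. Qed.

(** By evenness the mass is twice the integral over the right half-line, and the two half-lines make
    up the whole mass. *)
Lemma sym_cdf0 : F 0 = 1 / 2.
Proof.
have half (a b c : R) : c - a = b -> c = 2 * b -> a = 1 / 2 * c by lra.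
have gi' : mu.-integrable [set` Interval -oo%O +oo%O] (EFin \o g) by rewrite set_itvNyy.
have := @Rintegral_itvB R g -oo%O +oo%O 0 gi' isT isT.
rewrite Rintegral_itv_obnd_cbnd; last exact: integrableS gi.
have := ge0_symfun_integralT g_ge0 gc (fun x => esym (gN x)).
have -> : [set x : R | (0 <= x)%R] = `[0%R, +oo[%classic by rewrite set_itvE.
have fJ : (\int[mu]_(x in `[0%R, +oo[) (g x)%:E)%E \is a fin_num.
  by apply: integrable_fin_num => //; exact: integrableS gi.
move=> /(congr1 fine); rewrite fineM// => h1 h2.
rewrite set_itvNyy in h2.
have h3 : dens_mass g = 2 * \int[mu]_(x in `[0%R, +oo[) g x by exact: h1.
move: h2; rewrite -/(dens_mass g) => h2.
by rewrite /F /cdf_of (half _ _ _ h2 h3) mulfK.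
Qed.

(** Evenness of the density makes the derivative of [F (- x) + F x] vanish, so this sum keeps its
    value [1] at [0]. *)
Lemma sym_cdfN x : F (- x) = 1 - F x.
Proof.
pose K : R -> R := F \o -%R + F.
have K' y : is_derive y (1 : R) K 0.
  have h1 : is_derive y (1 : R) (F \o -%R) (- pdf_of g y).
    have h := sym_cdf_is_derive (- y).
    have h2 : is_derive y (1 : R) (-%R : R -> R) (- 1) by apply: is_deriveN.
    have := @is_derive1_comp R F -%R y _ _ h h2.
    by rewrite sym_pdfN mulrN1.
  have := is_deriveD h1 (sym_cdf_is_derive y).
  by rewrite addNr.
have := is_derive_0_is_cst x 0 K'; rewrite /K/= !fctE/= oppr0 sym_cdf0.
lra.
Qed.

Lemma sym_cdf_near1 (e : R) : 0 < e -> exists x0 : R, forall x : R, x0 <= x -> 1 - e < F x.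
Proof.
move=> e0.
pose D (n : nat) := `]-oo, n%:R : R]%classic.
have hD : {homo D : n m / (n <= m)%N >-> (n <= m)%O}.
  move=> n m nm; apply/subsetPset => x; rewrite /D/= !in_itv/= => /le_trans; apply.
  by rewrite ler_nat.
have UD : \bigcup_i D i = setT.
  apply/seteqP; split => // x _; exists (Num.truncn `|x|).+1 => //.
  rewrite /D/= in_itv/=; apply: (le_trans (ler_norm x)).
  by rewrite ltW// truncnS_gt.
have h : (\int[mu]_(x in D i) (g x)%:E)%E @[i --> \oo] --> (dens_mass g)%:E.
  rewrite /dens_mass /Rintegral fineK; last exact: integrable_fin_num.
  rewrite -UD; apply: ge0_nondecreasing_set_cvg_integral => //.
    by move=> i; rewrite /D; exact: measurable_itv.
    by move=> i; apply/measurable_EFinP; apply: measurable_funS mg.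
  by move=> i x _; rewrite lee_fin.
have {}h : F i%:R @[i --> \oo] --> (1 : R).
  have /fine_cvg h' := h.
  have := cvgM h' (cvg_cst (dens_mass g)^-1); rewrite divff//; exact.
have /cvgrPdist_lt /(_ _ e0) [N _ /(_ N)/=] := h.
rewrite leqnn => /(_ isT) hN.
exists N%:R => x Nx; apply: (lt_le_trans _ (sym_cdf_le Nx)).
move: hN; rewrite ltr_norml; lra.
Qed.

Lemma sym_cdf_near0 (e : R) : 0 < e -> exists x0 : R, forall x : R, x0 <= x -> F (- x) < e.
Proof.
by move=> /sym_cdf_near1[x0 h]; exists x0 => x /h; rewrite sym_cdfN; lra.
Qed.

Lemma sym_cdf_gt0 x : 0 < F x.
Proof.
apply: (@le_lt_trans _ _ (F (x - 1))); last by apply: sym_cdf_lt; rewrite ltrBlDr ltrDl.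
by apply: divr_ge0; [exact: Rintegral_ge0|exact: ltW].
Qed.

Lemma sym_cdf_lt1 x : F x < 1.
Proof. by have := sym_cdf_gt0 (- x); rewrite sym_cdfN; lra. Qed.

Lemma sym_cdf_surj (u : R) : 0 < u < 1 -> exists x, F x = u.
Proof.
move=> /andP[u0 u1].
have [a ha] := sym_cdf_near0 u0.
have [b hb] : exists x0 : R, forall x : R, x0 <= x -> 1 - (1 - u) < F x.
  by apply: sym_cdf_near1; lra.
pose m := Num.max 0 (Num.max a b).
have m0' : - m <= m by rewrite /m; have := le_max 0 0 (Num.max a b); rewrite lexx/= => h; lra.
have h1 : F (- m) < u by apply: ha; rewrite /m !le_max lexx orbT.
have h2 : u < F m.
  suff : 1 - (1 - u) < F m by lra.
  by apply: hb; rewrite /m !le_max lexx !orbT.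
have [|c _ <-] := @IVT R F (- m) m u m0' (continuous_subspaceT sym_cdf_continuous).
  by rewrite ge_min le_max (ltW h1) (ltW h2) orbT.
by exists c.
Qed.

Lemma sym_cdf_le_iff x y : (F x <= F y) = (x <= y).
Proof.
apply/idP/idP; last exact: sym_cdf_le.
by apply: contraTT; rewrite -!ltNge; exact: sym_cdf_lt.
Qed.

Lemma sym_cdf_lt_iff x y : (F x < F y) = (x < y).
Proof. by rewrite !ltNge sym_cdf_le_iff. Qed.

Lemma quantile_cdf x : quantile F (F x) = x.
Proof.
rewrite /quantile (_ : [set _ | _] = `[x, +oo[%classic) ?inf_itv//.
by apply/seteqP; split => y; rewrite /= sym_cdf_le_iff in_itv/= andbT.
Qed.

End SymmetricDensity.

Lemma is_derive_MVT (R : realType) (f df : R -> R) (a b : R) : a < b ->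
  (forall x : R, is_derive x (1 : R) f (df x)) ->
  exists2 c : R, a < c < b & f b - f a = df c * (b - a).
Proof.
move=> ab fd; have fc : continuous f.
  by move=> x; apply/differentiable_continuous/derivable1_diffP; case: (fd x).
have [c] := MVT ab (fun x _ => fd x) (continuous_subspaceT fc).
by rewrite in_itv/= => abc h; exists c.
Qed.

Lemma ln_lt_subr1 (R : realType) (x : R) : 0 < x -> x != 1 -> ln x < x - 1.
Proof.
move=> x0 x1; have l0 : ln x != 0 by rewrite ln_eq0.
by have := expR_gt1Dx l0; rewrite lnK ?posrE//; lra.
Qed.

(** * The Gaussian and Student kernels and the shape of their ratio *)

Section Kernels.
Variable R : realType.
Implicit Types nu x y : R.

Lemma gauss_kernel_gt0 y : 0 < gauss_kernel y.
Proof. exact: expR_gt0. Qed.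

Lemma gauss_kernelN y : gauss_kernel (- y) = gauss_kernel y.
Proof. by rewrite /gauss_kernel sqrrN. Qed.

Lemma gauss_kernel_continuous : continuous (@gauss_kernel R).
Proof.
move=> y; apply: continuous_comp; last exact: continuous_expR.
apply: cvgM; last exact: cvg_cst.
by apply: cvgN; exact: exprn_continuous.
Qed.

Lemma gauss_mass_neq0 : dens_mass (@gauss_kernel R) != 0.
Proof.
have /(congr1 fine) := integral_normal_pdf (R := R) 0 1.
rewrite normal_pdfE ?oner_neq0//.
have E (y : R) : normal_peak 1 * normal_fun 0 1 y = normal_peak 1 * gauss_kernel y :> R.
  by rewrite /normal_fun /gauss_kernel subr0 expr1n mulr2n.
under eq_integral do rewrite /= E EFinM.
rewrite ge0_integralZl//; last first.
- by rewrite lee_fin normal_peak_ge0.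
- by move=> y _; rewrite lee_fin ltW// gauss_kernel_gt0.
- apply/measurable_EFinP; exact: (continuous_measurable_fun gauss_kernel_continuous).
rewrite /dens_mass /Rintegral; case: integral => [r|/=|/=].
- by rewrite /= => h; apply/eqP => r0; move: h; rewrite r0 mulr0 => /esym/eqP; rewrite oner_eq0.
- by rewrite gt0_muley ?lte_fin ?normal_peak_gt0 ?oner_neq0//= => /esym/eqP; rewrite oner_eq0.
- by rewrite gt0_muleNy ?lte_fin ?normal_peak_gt0 ?oner_neq0//= => /esym/eqP; rewrite oner_eq0.
Qed.

Lemma gauss_symmetric : symmetric_density (@gauss_kernel R).
Proof.
split; [exact: gauss_kernel_continuous|exact: gauss_kernel_gt0|exact: gauss_kernelN|].
exact: gauss_mass_neq0.
Qed.

Lemma t_base_gt0 nu y : 0 < nu -> 0 < 1 + y ^+ 2 / nu.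
Proof. by move=> nu0; rewrite ltr_pwDl// divr_ge0 ?sqr_ge0// ltW. Qed.

Lemma t_kernelE nu y : 0 < nu ->
  t_kernel nu y = expR (- ((nu + 1) / 2) * ln (1 + y ^+ 2 / nu)).
Proof. by move=> nu0; rewrite /t_kernel /powR gt_eqF// t_base_gt0. Qed.

Lemma t_kernel_gt0 nu y : 0 < nu -> 0 < t_kernel nu y.
Proof. by move=> nu0; rewrite t_kernelE// expR_gt0. Qed.

Lemma t_kernelN nu y : t_kernel nu (- y) = t_kernel nu y.
Proof. by rewrite /t_kernel sqrrN. Qed.

Lemma t_kernel_continuous nu : 0 < nu -> continuous (t_kernel nu).
Proof.
move=> nu0; rewrite (_ : t_kernel nu = fun y => expR (- ((nu + 1) / 2) * ln (1 + y ^+ 2 / nu))); last first.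
  by apply/funext => y; exact: t_kernelE.
move=> y; apply: continuous_comp; last exact: continuous_expR.
apply: cvgM; first exact: cvg_cst.
apply: continuous_comp; last by apply: continuous_ln; exact: t_base_gt0.
apply: cvgD; first exact: cvg_cst.
apply: cvgM; last exact: cvg_cst.
exact: exprn_continuous.
Qed.

Lemma t_symmetric nu : 0 < nu -> dens_mass (t_kernel nu) != 0 ->
  symmetric_density (t_kernel nu).
Proof.
move=> nu0 mt; split => // [|x|x]; first exact: t_kernel_continuous.
  exact: t_kernel_gt0.
exact: t_kernelN.
Qed.

Lemma t_kernel_le nu x y : 0 < nu -> 0 <= x -> x <= y -> t_kernel nu y <= t_kernel nu x.
Proof.
move=> nu0 x0 xy; rewrite !t_kernelE// ler_expR !mulNr lerN2.
rewrite ler_pM2l ?divr_gt0 ?addr_gt0//.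
by rewrite ler_ln ?posrE ?t_base_gt0// lerD2l ler_pM2r ?invr_gt0// lerXn2r ?nnegrE// (le_trans x0).
Qed.

(* The log-ratio of the two kernels is a strictly convex function of the
   squared argument. *)
Lemma t_gauss_ratio_quasiconvex nu (s k a b c : R) : 0 < nu -> 0 <= a -> a < b -> b < c ->
  t_kernel nu a <= k * gauss_kernel (s * a) ->
  t_kernel nu c <= k * gauss_kernel (s * c) ->
  t_kernel nu b < k * gauss_kernel (s * b).
Proof.
move=> nu0 a0 ab bc.
(* [K] is the logarithm of [t_kernel nu y / gauss_kernel (s * y)]. *)
pose B := (nu + 1) / 2; pose A := s ^+ 2 / 2.
pose K (y : R) := A * y ^+ 2 - B * ln (1 + y ^+ 2 / nu).
have B0 : 0 < B by rewrite divr_gt0 ?addr_gt0.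
have E y : t_kernel nu y = expR (K y) * gauss_kernel (s * y).
  rewrite t_kernelE// /gauss_kernel -expRD; congr expR; rewrite /K /A -/B; lra.
rewrite !E !ler_pM2r ?ltr_pM2r ?gauss_kernel_gt0// => ha hc.
have nb : 0 < nu + b ^+ 2 by rewrite ltr_pwDl// sqr_ge0.
(* Strict supporting line of [K] at [b], in the variable [y ^+ 2]; it comes from [ln r < r - 1] for
   [r = (nu + y ^+ 2) / (nu + b ^+ 2)]. *)
have T y : 0 <= y -> y != b -> (y ^+ 2 - b ^+ 2) * (A - B / (nu + b ^+ 2)) < K y - K b.
  move=> y0 yb.
  have ny : 0 < nu + y ^+ 2 by rewrite ltr_pwDl// sqr_ge0.
  have : ln ((nu + y ^+ 2) / (nu + b ^+ 2)) < (nu + y ^+ 2) / (nu + b ^+ 2) - 1.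
    apply: ln_lt_subr1; first exact: divr_gt0.
    rewrite -subr_eq0 (_ : _ - 1 = (y ^+ 2 - b ^+ 2) / (nu + b ^+ 2)); last by field; rewrite gt_eqF.
    rewrite mulf_neq0 ?invr_eq0 ?(gt_eqF nb)// subr_eq0 eqf_sqr (negPf yb)/= gt_eqF//.
    by rewrite (lt_le_trans _ y0)// oppr_lt0 (le_lt_trans a0).
  rewrite ln_div ?posrE//.
  have lE z : 0 < nu + z ^+ 2 -> ln (1 + z ^+ 2 / nu) = ln (nu + z ^+ 2) - ln nu.
    by move=> z0; rewrite -ln_div ?posrE// mulrDl divff ?gt_eqF.
  rewrite /K !lE//.
  rewrite (_ : (nu + y ^+ 2) / (nu + b ^+ 2) - 1 = (y ^+ 2 - b ^+ 2) / (nu + b ^+ 2)); last first.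
    by field; rewrite gt_eqF.
  by rewrite -(ltr_pM2l B0); lra.
have b0 : 0 < b by exact: le_lt_trans ab.
(* The sign of the slope decides which endpoint lies strictly above [K b]: [c] when it is
   nonnegative, [a] when it is negative. *)
have [h|h] := leP 0 (A - B / (nu + b ^+ 2)).
- have := T c (ltW (lt_trans b0 bc)); rewrite gt_eqF// => /(_ isT) h2.
  suff : expR (K b) < expR (K c) by lra.
  rewrite ltr_expR -subr_gt0; apply: le_lt_trans h2; apply: mulr_ge0 => //.
  by rewrite subr_ge0 lerXn2r ?nnegrE ?(ltW b0) ?(ltW bc) ?(ltW (lt_trans b0 bc)).
- have := T a a0; rewrite lt_eqF// => /(_ isT) h2.
  suff : expR (K b) < expR (K a) by lra.
  rewrite ltr_expR -subr_gt0; apply: le_lt_trans h2; apply: mulr_le0; last exact: ltW.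
  by rewrite subr_le0 lerXn2r ?nnegrE ?(ltW b0) ?(ltW ab).
Qed.

End Kernels.

(** * Crossing points *)

Section CrossingGap.
Variables (R : realType) (nu alpha : R).
Hypothesis nu0 : 0 < nu.
Hypothesis alpha01 : 0 < alpha <= 1 / 2.
Hypothesis tS : symmetric_density (t_kernel nu).
Let gS : symmetric_density (@gauss_kernel R) := gauss_symmetric R.

(* [F_inf nu t s - t / alpha], times [alpha], in the variable [u] with [t = F_t nu (- u)]. *)
Definition gap (s u : R) : R := alpha * Phi (- (s * u)) - F_t nu (- u).
Definition dgap (s u : R) : R := f_t nu u - s * alpha * phi (s * u).

Let alpha0 : 0 < alpha. Proof. by case/andP: alpha01. Qed.

Lemma is_derive_cdf_opp (g : R -> R) (a u : R) : symmetric_density g ->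
  is_derive u (1 : R) (fun v => cdf_of g (- (a * v))) (- (a * pdf_of g (a * u))).
Proof.
move=> hg.
have h2 : is_derive u (1 : R) (fun v : R => - (a * v)) (- a).
  have h : is_derive u (1 : R) (fun v : R => a *: v) (a *: (1 : R)) by apply: is_deriveZ.
  by have := is_deriveN h; rewrite /GRing.scale/= mulr1.
have h1 := sym_cdf_is_derive hg (- (a * u)).
have := @is_derive1_comp R (cdf_of g) (fun v => - (a * v)) u _ _ h1 h2.
by rewrite sym_pdfN// mulrN [pdf_of _ _ * a]mulrC.
Qed.

Lemma gap_is_derive (s u : R) : is_derive u (1 : R) (gap s) (dgap s u).
Proof.
have h1 := is_deriveZ alpha (is_derive_cdf_opp s u gS).
have h2 := is_derive_cdf_opp 1 u tS.
have := is_deriveB h1 h2.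
rewrite (_ : _ - _ = gap s); last first.
  by apply/funext => v; rewrite /gap/= !fctE /GRing.scale/= mul1r.
by rewrite /dgap /f_t /phi /GRing.scale/= !mul1r opprK addrC mulrN mulrA (mulrC alpha).
Qed.

Lemma gap_continuous (s : R) : continuous (gap s).
Proof.
by move=> x; apply/differentiable_continuous/derivable1_diffP; case: (gap_is_derive s x).
Qed.

Lemma gap_lt_scale (s s' u : R) : 0 < u -> s < s' -> gap s' u < gap s u.
Proof.
move=> u0 ss'; rewrite ltrD2r ltr_pM2l//; apply: (sym_cdf_lt gS).
by rewrite ltrN2 ltr_pM2r.
Qed.

Lemma gap0_lt0 (s : R) : gap s 0 < 0.
Proof. have /andP[] := alpha01; rewrite /gap mulr0 oppr0 /Phi /F_t !sym_cdf0//; lra. Qed.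

(** Up to the positive factor [Mt], [dgap s] compares the Student kernel with [k] times the scaled
    Gaussian one, [k] absorbing [s], [alpha] and both masses; the convexity of the log-ratio then
    applies. *)
Lemma dgap_quasiconvex (s a b c : R) : 0 <= a -> a < b -> b < c ->
  dgap s a <= 0 -> dgap s c <= 0 -> dgap s b < 0.
Proof.
move=> a0 ab bc.
pose Mt := dens_mass (t_kernel nu); pose Mg := dens_mass (@gauss_kernel R).
have Mt0 : 0 < Mt by apply: dens_mass_gt0 => [x|]; [apply: ltW|]; case: tS.
have Mg0 : 0 < Mg by apply: dens_mass_gt0 => [x|]; [apply: ltW|]; case: gS.
pose k := s * alpha / Mg * Mt.
have E u : dgap s u = (t_kernel nu u - k * gauss_kernel (s * u)) / Mt.
  rewrite /dgap /f_t /phi /pdf_of -/Mt -/Mg /k.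
  by field; rewrite !gt_eqF.
rewrite !E !pmulr_lle0 ?pmulr_llt0 ?invr_gt0// !subr_le0 subr_lt0.
exact: t_gauss_ratio_quasiconvex.
Qed.

(* Differentiating [C * F_t nu (- u) ^+ 2 - Phi (- (s * u))] reduces the claim to
   [phi (s * u) <= const * f_t nu (u + 1) ^+ 2]. *)
Lemma Phi_tail_le_sqr (s : R) : 0 < s -> exists2 C : R, 0 < C &
  forall u, 0 <= u -> Phi (- (s * u)) <= C * F_t nu (- u) ^+ 2.
Proof.
move=> s0.
pose Mt := dens_mass (t_kernel nu); pose Mg := dens_mass (@gauss_kernel R).
have Mt0 : 0 < Mt by apply: dens_mass_gt0 => [x|]; [apply: ltW|]; case: tS.
have Mg0 : 0 < Mg by apply: dens_mass_gt0 => [x|]; [apply: ltW|]; case: gS.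
(* Chosen so that [(nu + 1) * b = s ^+ 2 / 2], the coefficient in the Gaussian exponent. *)
pose b := s ^+ 2 / (2 * (nu + 1)).
have nu1 : 0 < nu + 1 by rewrite addr_gt0.
have b0 : 0 < b by rewrite divr_gt0 ?exprn_gt0// mulr_gt0.
(* Large enough for [1 + (u + 1) ^+ 2 / nu <= A * (1 + b * u ^+ 2)], by way of
   [(u + 1) ^+ 2 <= 2 + 2 * u ^+ 2]. *)
pose A := 1 + 2 / nu + 2 / (nu * b).
have A1 : 1 <= A by rewrite /A -addrA lerDl addr_ge0// divr_ge0// ltW// mulr_gt0.
have A0 : 0 < A by exact: lt_le_trans A1.
pose L := (nu + 1) * ln A.
have kB (u : R) : 0 <= u -> gauss_kernel (s * u) <= expR L * t_kernel nu (u + 1) ^+ 2.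
  move=> u0; rewrite t_kernelE// /gauss_kernel -expRM_natl -expRD ler_expR.
  have h : ln (1 + (u + 1) ^+ 2 / nu) <= ln A + b * u ^+ 2.
    have bu : 0 <= b * u ^+ 2 by rewrite mulr_ge0 ?sqr_ge0 ?ltW.
    apply: (@le_trans _ _ (ln A + ln (1 + b * u ^+ 2))); last first.
      by rewrite lerD2l le_ln1Dx// (lt_le_trans _ bu).
    have bu1 : 0 < 1 + b * u ^+ 2 by rewrite ltr_pwDl.
    rewrite -lnM ?posrE// ler_ln ?posrE ?t_base_gt0 ?mulr_gt0//.
    apply: (@le_trans _ _ (1 + 2 / nu + 2 / nu * u ^+ 2)).
      rewrite -subr_ge0 (_ : _ - _ = (u - 1) ^+ 2 / nu); last by field; rewrite gt_eqF.
      by rewrite divr_ge0 ?sqr_ge0 ?ltW.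
    rewrite mulrDr mulr1 lerD//; first by rewrite /A lerDl divr_ge0// ltW// mulr_gt0.
    rewrite mulrA ler_wpM2r ?sqr_ge0// -ler_pdivrMr// /A.
    rewrite (_ : 2 / nu / b = 2 / (nu * b)); last by field; rewrite !gt_eqF.
    by rewrite lerDr addr_ge0// divr_ge0// ltW.
  rewrite exprMn /L.
  have : (nu + 1) * ln (1 + (u + 1) ^+ 2 / nu) <= (nu + 1) * (ln A + b * u ^+ 2).
    by rewrite ler_pM2l.
  have -> : (nu + 1) * (ln A + b * u ^+ 2) = (nu + 1) * ln A + s ^+ 2 * u ^+ 2 / 2.
    by rewrite /b; field; rewrite gt_eqF.
  by lra.
pose C := s * expR L * Mt ^+ 2 / Mg.
have C0 : 0 < C by rewrite !(mulr_gt0, divr_gt0, exprn_gt0, expR_gt0)// invr_gt0.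
exists C => //.
pose D (u : R) := C * F_t nu (- u) ^+ 2 - Phi (- (s * u)).
pose dD (u : R) := - (2 * C * F_t nu (- u) * f_t nu u) + s * phi (s * u).
have DD (u : R) : is_derive u (1 : R) D (dD u).
  have h1 := is_derive_cdf_opp s u gS.
  have h2 := is_derive_cdf_opp 1 u tS.
  have h3 := is_deriveZ C (is_deriveM h2 h2).
  have := is_deriveB h3 h1.
  rewrite (_ : _ - _ = D); last first.
    by apply/funext => v; rewrite /D/= !fctE /GRing.scale/= mul1r expr2.
  congr (is_derive _ _ _ _); rewrite /dD /GRing.scale/= /F_t /f_t /phi !mul1r.
  by ring.
(* The mass of the unit interval from [- (u + 1)] to [- u] is at least the density at its outer
   end. *)
have tail (u : R) : 0 <= u -> f_t nu (u + 1) <= F_t nu (- u).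
  move=> u0.
  have [|c /andP[c1 c2] hc] := is_derive_MVT _ (sym_cdf_is_derive tS) (a := - (u + 1)) (b := - u).
    by rewrite ltrN2 ltrDl.
  have /(_ (- (u + 1))) h := sym_cdf_gt0 tS.
  have : f_t nu (u + 1) <= pdf_of (t_kernel nu) c.
    rewrite -(sym_pdfN tS) /f_t /pdf_of ler_pM2r ?invr_gt0// t_kernel_le//; lra.
  move: hc h; rewrite (_ : - u - - (u + 1) = 1) ?mulr1 /F_t; last by ring.
  lra.
have dD0 (u : R) : 0 <= u -> dD u <= 0.
  move=> u0; rewrite /dD addrC subr_le0.
  have h1 := tail u u0.
  have h0 (v : R) : 0 < f_t nu v by exact: (sym_pdf_gt0 tS).
  have h2 : f_t nu (u + 1) <= f_t nu u.
    by rewrite /f_t /pdf_of ler_pM2r ?invr_gt0// t_kernel_le// lerDl.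
  apply: (@le_trans _ _ (C * f_t nu (u + 1) ^+ 2)).
    rewrite /phi /f_t /pdf_of -/Mg -/Mt /C.
    rewrite (_ : _ * _ ^+ 2 = s * (expR L * t_kernel nu (u + 1) ^+ 2 / Mg)); last first.
      by field; rewrite !gt_eqF.
    by rewrite ler_pM2l// ler_pM2r ?invr_gt0// kB.
  have h3 : C * f_t nu (u + 1) ^+ 2 <= C * (F_t nu (- u) * f_t nu u).
    by rewrite ler_pM2l// expr2 ler_pM// ltW.
  apply: (le_trans h3).
  have : 0 <= C * (F_t nu (- u) * f_t nu u).
    by rewrite mulr_ge0 ?ltW// mulr_gt0//; exact: (sym_cdf_gt0 tS).
  lra.
(* [D] is nonincreasing on the half-line, so a negative value would persist; but
   [D v >= - Phi (- (s * v))], which tends to [0]. *)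
move=> u u0; rewrite -subr_ge0 -/(D u) leNgt; apply/negP => Du.
have := sym_cdf_near0 gS (e := - D u); rewrite oppr_gt0 => /(_ Du)[x0 hx].
pose v := Num.max (u + 1) (x0 / s).
have uv : u < v by rewrite /v lt_max ltrDl ltr01.
have [c /andP[c1 c2] hc] := is_derive_MVT uv DD.
have h1 : D v <= D u.
  rewrite -subr_le0 hc mulr_le0_ge0 ?subr_ge0 ?(ltW uv)// dD0//.
  by rewrite (le_trans u0)// ltW.
have h2 : Phi (- (s * v)) < - D u.
  by apply: hx; rewrite mulrC -ler_pdivrMr// /v le_max lexx orbT.
have h3 : - Phi (- (s * v)) <= D v.
  by rewrite /D lerDr mulr_ge0 ?sqr_ge0// ltW.
by lra.
Qed.

(** The Gaussian tail is at most [C] times the square of the Student tail, hence it loses as soon as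
    [F_t nu (- u) < (alpha * C)^-1]. *)
Lemma gap_eventually_lt0 (s : R) : 0 < s -> exists2 U : R, 0 < U & forall u, U <= u -> gap s u < 0.
Proof.
move=> s0; have [C C0 hC] := Phi_tail_le_sqr s0.
have aC : 0 < (alpha * C)^-1 by rewrite invr_gt0 mulr_gt0.
have [x0 hx] := sym_cdf_near0 tS aC.
exists (Num.max 1 x0); first by rewrite lt_max ltr01.
move=> u; rewrite ge_max => /andP[u1 ux].
have h1 := hx u ux.
have Fu : 0 < F_t nu (- u) by exact: (sym_cdf_gt0 tS).
rewrite /gap subr_lt0; apply: (@le_lt_trans _ _ (alpha * (C * F_t nu (- u) ^+ 2))).
  by rewrite ler_pM2l// hC// (le_trans _ u1).
rewrite mulrA expr2 mulrA gtr_pMl//.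
by rewrite mulrC -ltr_pdivlMr ?mulr_gt0// div1r.
Qed.

(** A nonnegative gap must eventually turn negative, so it decreases somewhere later. This supplies
    the right-hand point in the applications of [dgap_quasiconvex]. *)
Lemma dgap_le0_after (s v : R) : 0 < s -> 0 <= v -> 0 <= gap s v ->
  exists2 w, v < w & dgap s w <= 0.
Proof.
move=> s0 v0 gv; have [U U0 hU] := gap_eventually_lt0 s0.
pose z := Num.max U (v + 1).
have vz : v < z by rewrite /z lt_max ltrDl ltr01 orbT.
have [c /andP[c1 c2] hc] := is_derive_MVT vz (gap_is_derive s).
exists c => //.
have : dgap s c * (z - v) <= 0.
  by rewrite -hc subr_le0 (le_trans _ gv)// ltW// hU// /z le_max lexx.
by rewrite pmulr_lle0// subr_gt0.
Qed.

Section Tangent.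
Variables (s0 u2 : R).
Hypotheses (s00 : 0 < s0) (u20 : 0 < u2) (g0 : gap s0 u2 = 0) (dg0 : dgap s0 u2 = 0).

(** A second nonnegative value left of [u2] would put points with [dgap <= 0] on both sides of [u2],
    forcing [dgap s0 u2 < 0]. One to the right would put a point with [dgap >= 0] between [u2] and a
    later point with [dgap <= 0]. *)
Lemma gap_tangent_lt0 (u : R) : 0 <= u -> u != u2 -> gap s0 u < 0.
Proof.
move=> u0; rewrite neq_lt => /orP[uu2|u2u]; rewrite ltNge; apply/negP => gu.
- have [c /andP[c1 c2] hc] := is_derive_MVT uu2 (gap_is_derive s0).
  have dc : dgap s0 c <= 0.
    have : dgap s0 c * (u2 - u) <= 0 by rewrite -hc g0 sub0r oppr_le0.
    by rewrite pmulr_lle0// subr_gt0.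
  have [w w1 w2] : exists2 w, u2 < w & dgap s0 w <= 0.
    by apply: dgap_le0_after; rewrite ?g0// ltW.
  have := dgap_quasiconvex (le_trans u0 (ltW c1)) c2 w1 dc w2.
  by rewrite dg0 ltxx.
- have [c /andP[c1 c2] hc] := is_derive_MVT u2u (gap_is_derive s0).
  have dc : 0 <= dgap s0 c.
    have : 0 <= dgap s0 c * (u - u2) by rewrite -hc g0 subr0.
    by rewrite pmulr_lge0// subr_gt0.
  have [w w1 w2] := dgap_le0_after s00 u0 gu.
  have dg : dgap s0 u2 <= 0 by rewrite dg0.
  have := dgap_quasiconvex (ltW u20) c1 (lt_trans c2 w1) dg w2.
  by rewrite ltNge dc.
Qed.

(** For [s < s0] the gap is positive at [u2]. If it had fallen to [0] or below at [v], it would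
    decrease, then increase towards [u2], then decrease beyond; [dgap_quasiconvex] forbids this sign
    pattern. *)
Lemma gap_single_crossing (s u v : R) : 0 < s < s0 -> 0 <= u -> u < v -> v <= u2 ->
  0 <= gap s u -> 0 < gap s v.
Proof.
move=> /andP[sp ss0] u0 uv vu2 gu.
have gu2 : 0 < gap s u2 by rewrite -g0 gap_lt_scale.
move: vu2; rewrite le_eqVlt => /predU1P[->//|vu2].
rewrite ltNge; apply/negP => gv.
have [c /andP[c1 c2] hc] := is_derive_MVT uv (gap_is_derive s).
have dc : dgap s c <= 0.
  have : dgap s c * (v - u) <= 0 by rewrite -hc subr_le0 (le_trans gv).
  by rewrite pmulr_lle0// subr_gt0.
have [e /andP[e1 e2] he] := is_derive_MVT vu2 (gap_is_derive s).
have de : 0 < dgap s e.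
  have : 0 < dgap s e * (u2 - v) by rewrite -he subr_gt0 (le_lt_trans gv).
  by rewrite pmulr_lgt0// subr_gt0.
have [w w1 w2] := dgap_le0_after sp (ltW u20) (ltW gu2).
have := dgap_quasiconvex (le_trans u0 (ltW c1)) (lt_trans c2 e1) (lt_trans e2 w1) dc w2.
by rewrite ltNge (ltW de).
Qed.

End Tangent.
End CrossingGap.

Lemma sup_eq_maximum (R : realType) (A : set R) (m : R) : A m -> ubound A m -> sup A = m.
Proof.
move=> Am ub; apply/eqP; rewrite eq_le; apply/andP; split.
- by apply: ge_sup => //; exists m.
- by apply: ub_le_sup => //; exists m.
Qed.

(** * From the gap in [u] back to levels [t], and the set of largest crossing points *)

Section CrossingPoints.
Variables (R : realType) (nu alpha : R).
Hypothesis nu0 : 0 < nu.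
Hypothesis alpha01 : 0 < alpha <= 1 / 2.
Hypothesis tS : symmetric_density (t_kernel nu).
Let gS : symmetric_density (@gauss_kernel R) := gauss_symmetric R.
Let alpha0 : 0 < alpha. Proof. by case/andP: alpha01. Qed.
Let alphah : alpha <= 1 / 2. Proof. by case/andP: alpha01. Qed.
Local Notation F := (F_t nu).
Local Notation gap := (gap nu alpha).

Lemma F_t_tail (u : R) : 1 - F (- u) = F u.
Proof. by rewrite /F_t (sym_cdfN tS); lra. Qed.

Lemma quantile_F_t (u : R) : quantile F (1 - F (- u)) = u.
Proof. by rewrite F_t_tail (quantile_cdf tS). Qed.

Lemma F_t_gt0 (u : R) : 0 < F u.
Proof. exact: sym_cdf_gt0. Qed.

Lemma Phi_gt0 (u : R) : 0 < Phi u.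
Proof. exact: sym_cdf_gt0. Qed.

Lemma Phi_oppE (u : R) : Phi (- u) = 1 - Phi u.
Proof. exact: sym_cdfN. Qed.

Lemma tail_param (t : R) : 0 < t < 1 -> exists u, t = F (- u).
Proof.
by move=> t01; have [x <-] := sym_cdf_surj tS t01; exists (- x); rewrite opprK.
Qed.

Lemma tail_ge0 (u : R) : F (- u) <= 1 / 2 -> 0 <= u.
Proof. by rewrite -(sym_cdf0 tS) (sym_cdf_le_iff tS) oppr_le0. Qed.

Lemma tail_gt0 (u : R) : F (- u) < 1 / 2 -> 0 < u.
Proof. by rewrite -(sym_cdf0 tS) (sym_cdf_lt_iff tS) oppr_lt0. Qed.

Lemma tail_lt (u v : R) : (F (- u) < F (- v)) = (v < u).
Proof. by rewrite (sym_cdf_lt_iff tS) ltrN2. Qed.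

Lemma tail_le (u v : R) : (F (- u) <= F (- v)) = (v <= u).
Proof. by rewrite (sym_cdf_le_iff tS) lerN2. Qed.

Lemma tail_param_alpha (t : R) : 0 < t <= alpha -> exists2 u, 0 <= u & t = F (- u).
Proof.
have ah := alphah; move=> /andP[t0 ta]; have [|u tu] := @tail_param t; first by rewrite t0/=; lra.
by exists u => //; apply: tail_ge0; rewrite -tu; lra.
Qed.

Lemma F_inf_tail (s u : R) : F_inf nu (F (- u)) s = Phi (- (s * u)).
Proof.
rewrite /F_inf leNgt F_t_gt0/= leNgt (sym_cdf_lt1 tS)/= quantile_F_t.
by rewrite Phi_oppE.
Qed.

Lemma F_inf_gap (s u : R) : F_inf nu (F (- u)) s - F (- u) / alpha = gap s u / alpha.
Proof. by rewrite F_inf_tail /gap; field; rewrite gt_eqF. Qed.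

Lemma F_inf_gtP (s u : R) : (F_inf nu (F (- u)) s > F (- u) / alpha) = (0 < gap s u).
Proof. by rewrite -subr_gt0 F_inf_gap pmulr_lgt0// invr_gt0. Qed.

Lemma F_inf_ltP (s u : R) : (F_inf nu (F (- u)) s < F (- u) / alpha) = (gap s u < 0).
Proof. by rewrite -subr_lt0 F_inf_gap pmulr_llt0// invr_gt0. Qed.

Lemma F_inf_eqP (s u : R) : (F_inf nu (F (- u)) s = F (- u) / alpha) <-> (gap s u = 0).
Proof.
split=> [/eqP|/eqP h].
  by rewrite -subr_eq0 F_inf_gap mulf_eq0 invr_eq0 (gt_eqF alpha0) orbF => /eqP.
by apply/eqP; rewrite -subr_eq0 F_inf_gap mulf_eq0 h.
Qed.

Lemma F_inf0 (s t : R) : t <= 0 -> F_inf nu t s = 0.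
Proof. by move=> t0; rewrite /F_inf t0. Qed.

(* At [u = 0] both sides are [0], since [x / 0 = 0]. *)
Lemma s_one_tail (z u : R) : alpha * Phi (- z) = F (- u) ->
  s_one nu alpha (F (- u)) = z / u.
Proof.
move=> h; rewrite /s_one quantile_F_t -h mulrAC divff ?gt_eqF// mul1r.
by rewrite Phi_oppE opprB addrC subrK (quantile_cdf gS).
Qed.

Section Tangent.
Variables (s0 u2 : R).
Hypotheses (s00 : 0 < s0) (u20 : 0 < u2).
Hypotheses (g0 : gap s0 u2 = 0) (dg0 : dgap nu alpha s0 u2 = 0).

Let tan_lt (u : R) := gap_tangent_lt0 nu0 alpha01 tS s00 u20 g0 dg0 (u := u).

Lemma gap_lt0_above_tangent (s u : R) : s0 < s -> 0 <= u -> gap s u < 0.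
Proof.
move=> ss; rewrite le_eqVlt => /predU1P[<-|u0]; first exact: gap0_lt0.
apply: (lt_le_trans (gap_lt_scale nu alpha01 u0 ss)).
have [->|uu] := eqVneq u u2; first by rewrite g0.
by apply/ltW/tan_lt => //; exact: ltW.
Qed.

Lemma scale_lt_tangent (s u : R) : 0 <= u -> u != u2 -> gap s u = 0 -> s < s0.
Proof.
move=> u0 uu gu; rewrite ltNge le_eqVlt; apply/negP => /orP[/eqP E|ss].
  by have := tan_lt u0 uu; rewrite E gu ltxx.
by have := gap_lt0_above_tangent ss u0; rewrite gu ltxx.
Qed.

Lemma gap_lt0_before (s u v : R) : 0 < s < s0 -> gap s u = 0 -> u <= u2 ->
  0 <= v -> v < u -> gap s v < 0.
Proof.
move=> ss gu uu v0 vu; rewrite ltNge; apply/negP => gv.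
have := gap_single_crossing nu0 alpha01 tS u20 g0 ss v0 vu uu gv.
by rewrite gu ltxx.
Qed.

Lemma gap_gt0_after (s u v : R) : 0 < s < s0 -> gap s u = 0 -> 0 <= u ->
  u < v -> v <= u2 -> 0 < gap s v.
Proof.
move=> ss gu u0 uv vu; apply: (gap_single_crossing nu0 alpha01 tS u20 g0 ss u0 uv vu).
by rewrite gu.
Qed.

Lemma t_one_above (s : R) : s0 < s -> t_one nu alpha s = 0.
Proof.
(* The level [0] always solves the crossing equation, since [F_inf] and the line both vanish
   there. *)
move=> ss; apply: sup_eq_maximum => /=.
  by rewrite lexx ltW// F_inf0// mul0r.
move=> t /= [/andP[t0 ta]]; move: t0; rewrite [0 <= t]le_eqVlt => /orP[/eqP<-//|t0].
have [|u u0 ->] := @tail_param_alpha t; first by rewrite t0.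
by move/F_inf_eqP => gu; have := gap_lt0_above_tangent ss u0; rewrite gu ltxx.
Qed.

Lemma tail_le_alpha (s u : R) : gap s u = 0 -> F (- u) <= alpha.
Proof.
move=> /eqP; rewrite subr_eq0 => /eqP <-; rewrite ger_pMr//.
exact/ltW/(sym_cdf_lt1 gS).
Qed.

Lemma t_one_tangent : t_one nu alpha s0 = F (- u2).
Proof.
apply: sup_eq_maximum => /=.
  rewrite (ltW (F_t_gt0 _)) (tail_le_alpha g0); split=> //.
  exact/F_inf_eqP.
move=> t /= [/andP[t0 ta]]; move: t0; rewrite [0 <= t]le_eqVlt => /orP[/eqP<- _|t0].
  exact/ltW/F_t_gt0.
have [|u u0 ->] := @tail_param_alpha t; first by rewrite t0.
move/F_inf_eqP => gu; have [->//|uu] := eqVneq u u2.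
by have := tan_lt u0 uu; rewrite gu ltxx.
Qed.

(** Levels decrease in [u], so the largest crossing level corresponds to the smallest zero; before
    [u] the gap is negative, hence no zero precedes it. *)
Lemma t_one_below (s u : R) : 0 < s < s0 -> 0 <= u <= u2 -> gap s u = 0 ->
  t_one nu alpha s = F (- u).
Proof.
move=> ss /andP[u0 uu] gu; apply: sup_eq_maximum => /=.
  rewrite (ltW (F_t_gt0 _)) (tail_le_alpha gu); split=> //.
  exact/F_inf_eqP.
move=> t /= [/andP[t0 ta]]; move: t0; rewrite [0 <= t]le_eqVlt => /orP[/eqP<- _|t0].
  exact/ltW/F_t_gt0.
have [|v v0 ->] := @tail_param_alpha t; first by rewrite t0.
move/F_inf_eqP => gv; rewrite tail_le leNgt; apply/negP => vu.
by have := gap_lt0_before ss gu uu v0 vu; rewrite gv ltxx.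
Qed.

(** Scales above [s0] contribute [0], the scale [s0] contributes nothing, and the scales below [s0]
    sweep out the open interval. *)
Lemma C_one_tangent : C_one nu alpha = [set 0] `|` `]F (- u2), alpha / 2[%classic.
Proof.
have a0 := alpha0; have ah := alphah.
apply/seteqP; split => t /=.
- move=> [s sp [[[e e0 hl] _] ->]].
  have [ss|ss|E] := ltgtP s s0; last 2 first.
  + by left; exact: t_one_above.
  (* At the tangent scale the curve stays below the line on both sides of the contact, so the
     left-hand condition fails at a point [v] slightly beyond [u2]. *)
  + move: hl; rewrite E t_one_tangent => hl.
    have [v v1 v2] : exists2 v, u2 < v & F (- u2) - e < F (- v).
      pose m := Num.max (F (- u2) - e) (F (- u2) / 2).
      have F0 : 0 < F (- u2) by exact: F_t_gt0.
      have F1 : F (- u2) < 1 by exact: (sym_cdf_lt1 tS).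
      have m1 : F (- u2) - e <= m by rewrite /m le_max lexx.
      have m2 : F (- u2) / 2 <= m by rewrite /m le_max lexx orbT.
      have m3 : m < F (- u2) by rewrite /m gt_max; apply/andP; split; lra.
      have [|u hu] := @tail_param ((m + F (- u2)) / 2); first by apply/andP; split; lra.
      by exists u; [rewrite -tail_lt|]; lra.
    have := hl (F (- v)); rewrite v2 tail_lt v1 => /(_ isT).
    rewrite F_inf_gtP => gv.
    have := tan_lt (ltW (lt_trans u20 v1)) (negbT (gt_eqF v1)).
    by rewrite ltNge (ltW gv).
  + right.
    have s0s : 0 < s < s0 by rewrite sp.
    have gu2 : 0 < gap s u2 by rewrite -g0 gap_lt_scale.
    have gz := gap0_lt0 alpha01 tS s.
    have [|u] := @IVT R (gap s) 0 u2 0 (ltW u20) (continuous_subspaceT (@gap_continuous _ _ _ tS s)).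
      by rewrite ge_min le_max (ltW gz) (ltW gu2) orbT.
    rewrite in_itv/= => /andP[u0 uu] gu; move: u0; rewrite [0 <= u]le_eqVlt => /orP[/eqP E|u0].
      by move: gu; rewrite -E => gu; move: gz; rewrite gu ltxx.
    rewrite (@t_one_below s u) ?(ltW u0)// in_itv/= tail_lt; apply/andP; split.
      rewrite lt_neqAle uu andbT; apply/eqP => E; move: gu2; rewrite -E gu ltxx//.
    move/eqP: gu; rewrite subr_eq0 => /eqP <-; rewrite ltr_pM2l//.
    by rewrite -[X in _ < X]mul1r -(sym_cdf0 gS) (sym_cdf_lt_iff gS) oppr_lt0 mulr_gt0.
- move=> [->|].
    (* Any scale above [s0] serves. To the left of [0] the curve is [0] while the line is
       negative. *)
    exists (s0 + 1); first by rewrite addr_gt0.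
    have ss : s0 < s0 + 1 by rewrite ltrDl.
    rewrite /is_LCP t_one_above//; split=> //; split.
      by exists 1 => // v /andP[_ v0]; rewrite F_inf0 ?ltW// ltr_pdivrMr// mul0r.
    exists alpha => // v /andP[v0]; rewrite add0r => va.
    have [|u u0 ->] := @tail_param_alpha v; first by rewrite v0 ltW.
    by rewrite F_inf_ltP gap_lt0_above_tangent.
  rewrite in_itv/= => /andP[t2t ta].
  have [|u u0 tu] := @tail_param_alpha t.
    by rewrite (lt_trans (F_t_gt0 _) t2t)/=; lra.
  move: t2t ta; rewrite tu tail_lt => uu ua.
  have [|z hz] := sym_cdf_surj gS (u := F (- u) / alpha).
    rewrite divr_gt0 ?F_t_gt0//= ltr_pdivrMr// mul1r (lt_trans ua)//; lra.
  have {}u0 : 0 < u by apply: tail_gt0; lra.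
  have z0 : z < 0.
    rewrite -(sym_cdf_lt_iff gS) hz (sym_cdf0 gS) ltr_pdivrMr//; lra.
  (* The scale that solves [gap s u = 0], as [alpha * Phi z = F (- u)]; it is positive because the
     level is below [alpha / 2], which makes [z] negative. *)
  pose s := - z / u.
  have gu : gap s u = 0.
    rewrite /gap /s divfK ?gt_eqF// opprK /Phi hz mulrC divfK ?gt_eqF// subrr//.
  have s0s : 0 < s < s0.
    rewrite (scale_lt_tangent _ _ gu) ?(ltW u0) ?lt_eqF// andbT.
    by rewrite divr_gt0// oppr_gt0.
  exists s; first by case/andP: s0s.
  rewrite /is_LCP (@t_one_below s u) ?(ltW u0) ?(ltW uu)//; split=> //; split.
    (* The left neighbourhood reaches down to the tangent level, that is, [u] runs up to [u2], where
       [gap_gt0_after] applies. *)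
    exists (F (- u) - F (- u2)); first by rewrite subr_gt0 tail_lt.
    move=> t'; rewrite subKr => /andP[h1 h2].
    have [|v tv] := @tail_param t'.
      by rewrite (lt_trans (F_t_gt0 _) h1) (lt_trans h2 (sym_cdf_lt1 tS _)).
    move: h1 h2; rewrite tv !tail_lt => h1 h2; rewrite F_inf_gtP.
    exact: (gap_gt0_after s0s gu (ltW u0) h2 (ltW h1)).
  exists (alpha - F (- u)); first by rewrite subr_gt0 (lt_trans ua)//; lra.
  move=> t'; rewrite addrC subrK => /andP[h1 h2].
  have [|v v0 tv] := @tail_param_alpha t'; first by rewrite (lt_trans (F_t_gt0 _) h1) ltW.
  move: h1; rewrite tv tail_lt => h1; rewrite F_inf_ltP.
  exact: (gap_lt0_before s0s gu (ltW uu) v0 h1).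
Qed.

End Tangent.
End CrossingPoints.

(** * The linear step-up procedure *)

Section StepUp.
Variables (R : realType) (n : nat) (alpha : R) (p : 'I_n -> R).
Hypothesis alpha0 : 0 < alpha.

Definition below (c : R) : {set 'I_n} := [set i | p i <= c].

Lemma below_le c c' : c <= c' -> (#|below c| <= #|below c'|)%N.
Proof. by move=> cc; apply/subset_leq_card/fintype.subsetP => i; rewrite !inE => /le_trans; apply. Qed.

(** Replaces order statistics by counts, through which the procedure is studied from here on. *)
Lemma ord_stat_le i c : (0 < i <= n)%N -> (ord_stat p i <= c) = (i <= #|below c|)%N.
Proof.
move=> /andP[i0 ni]; rewrite /ord_stat; set s := sort _ _.
have ss : sorted <=%R s by apply: sort_le_sorted.
have sz : size s = n by rewrite size_sort size_map size_enum_ord.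
have -> : #|below c| = count (<= c) s.
  rewrite count_sort count_map enumT cardE /enum_mem size_filter.
  by apply: eq_count => j; rewrite /= inE.
have is' : (i.-1 < size s)%N by rewrite sz prednK.
apply/idP/idP => [h|h].
- rewrite leqNgt; apply/negP => h'; move: h; rewrite leNgt => /negP; apply.
  by apply: nth_count_gt => //; rewrite is' andbT -ltnS prednK.
- by apply: nth_count_le => //; rewrite prednK.
Qed.

Lemma LSU_m_le j : (0 < j <= n)%N -> (j <= #|below (j%:R * alpha / n%:R)|)%N ->
  (j <= LSU_m alpha p)%N.
Proof.
move=> /andP[j0 jn] h; rewrite /LSU_m.
have jn' : (j < n.+1)%N by [].
by apply: (@leq_bigmax_cond _ _ _ (Ordinal jn')) => /=; rewrite j0/= ord_stat_le ?j0.
Qed.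

Lemma LSU_m_below : (0 < LSU_m alpha p)%N ->
  (LSU_m alpha p <= n)%N /\ (LSU_m alpha p <= #|below ((LSU_m alpha p)%:R * alpha / n%:R)|)%N.
Proof.
(* The guard [0 < m] covers the value [0] of an empty maximum, so that [good] passes through the big
   operator. *)
pose good m := (0 < m)%N ->
  (m <= n)%N /\ (m <= #|below (m%:R * alpha / n%:R)|)%N.
rewrite -/(good (LSU_m alpha p)); apply: (big_ind good) => [//|x y gx gy|k /andP[k0 hk] _].
- by rewrite /maxn; case: ifP.
- by rewrite -ltnS ltn_ord; split=> //; rewrite -ord_stat_le// k0 -ltnS ltn_ord.
Qed.

(** The number [r] of rejections is at least [m]. Its own critical value is then at least that of
    [m], so [r] satisfies the step-up condition too, and maximality of [m] gives [r <= m]. *)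
Lemma card_LSU_rej : #|LSU_rej alpha p| = LSU_m alpha p.
Proof.
rewrite /LSU_rej; case: posnP => [m0|m0].
  by rewrite m0; apply: eq_card0 => i; rewrite !inE.
have [mn mb] := LSU_m_below m0.
apply/eqP; rewrite eqn_leq mb andbT -/(below _).
set r := #|_|.
have r0 : (0 < r)%N by exact: leq_trans mb.
apply: LSU_m_le.
  by rewrite r0/= (leq_trans (max_card _))// card_ord.
apply: below_le; rewrite ler_wpM2r ?invr_ge0 ?ler0n// ler_wpM2r ?(ltW alpha0)// ler_nat.
exact: mb.
Qed.

Lemma leq_card_LSU_rej j : (0 < j <= n)%N ->
  (j <= #|below (j%:R * alpha / n%:R)|)%N -> (j <= #|LSU_rej alpha p|)%N.
Proof. by rewrite card_LSU_rej; exact: LSU_m_le. Qed.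

Lemma LSU_rejE : (0 < #|LSU_rej alpha p|)%N ->
  LSU_rej alpha p = below (#|LSU_rej alpha p|%:R * alpha / n%:R).
Proof.
rewrite card_LSU_rej => m0; rewrite /LSU_rej m0/=.
by apply/setP => i; rewrite !inE.
Qed.

End StepUp.

(** The procedure sees the p-values only through finitely many comparisons with critical values; its
    measurability will rest on this. *)
Lemma eq_LSU_rej (R : realType) n (alpha : R) (p q : 'I_n -> R) :
  (forall j i, (j < n.+1)%N -> (p i <= j%:R * alpha / n%:R) = (q i <= j%:R * alpha / n%:R)) ->
  LSU_rej alpha p = LSU_rej alpha q.
Proof.
move=> pq.
have bE j : (j < n.+1)%N -> below p (j%:R * alpha / n%:R) = below q (j%:R * alpha / n%:R).
  by move=> jn; apply/setP => i; rewrite !inE pq.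
have mE : LSU_m alpha p = LSU_m alpha q.
  apply: eq_bigl => k; case: posnP => //= k0.
  by rewrite !ord_stat_le ?bE// k0 -ltnS ltn_ord.
apply/setP => i; rewrite !inE mE; case: posnP => //= m0.
by rewrite pq// ltnS; case: (LSU_m_below m0).
Qed.

(** * Chebyshev's inequality for counts *)

Section RealProbability.
Context (R : realType) d (T : measurableType d) (P : probability T R).

Definition Pr (A : set T) : R := fine (P A).

Lemma PrE (A : set T) : measurable A -> P A = (Pr A)%:E.
Proof. by move=> mA; rewrite /Pr fineK// fin_num_measure. Qed.

Lemma Pr_ge0 (A : set T) : 0 <= Pr A.
Proof. by rewrite /Pr fine_ge0. Qed.

Lemma Pr_le (A B : set T) : measurable A -> measurable B -> A `<=` B -> Pr A <= Pr B.
Proof.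
by move=> mA mB AB; rewrite -lee_fin -!PrE//; apply: le_measure; rewrite ?inE.
Qed.

Lemma Pr_setT : Pr setT = 1.
Proof. by rewrite /Pr probability_setT. Qed.

Lemma Pr_le1 (A : set T) : measurable A -> Pr A <= 1.
Proof. by move=> mA; rewrite -Pr_setT; apply: Pr_le. Qed.

Lemma Pr_setU (A B : set T) : measurable A -> measurable B ->
  Pr (A `|` B) <= Pr A + Pr B.
Proof.
move=> mA mB; rewrite -lee_fin EFinD -!PrE//; last exact: measurableU.
exact: measureU2.
Qed.

Lemma Pr_bigcup_le (k : nat) (A : nat -> set T) (e : R) : (forall i, measurable (A i)) ->
  (forall i, (i < k)%N -> Pr (A i) <= e) ->
  Pr (\big[setU/set0]_(i < k) A i) <= k%:R * e.
Proof.
move=> mA; elim: k => [|k IH] hA; first by rewrite big_ord0 /Pr measure0 mul0r.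
rewrite big_ord_recr/=; apply: (le_trans (Pr_setU _ _)) => //; first exact: bigsetU_measurable.
by rewrite -natr1 mulrDl mul1r lerD ?hA// IH// => i ik; rewrite hA// ltnS ltnW.
Qed.

Lemma Pr_setC (A : set T) : measurable A -> Pr (~` A) = 1 - Pr A.
Proof.
by move=> mA; rewrite /Pr probability_setC// fineB ?fin_num_measure.
Qed.

Lemma integral_indic_Pr (A : set T) : measurable A ->
  (\int[P]_w (\1_A w : R)%:E)%E = (Pr A)%:E.
Proof. by move=> mA; rewrite integral_indic// setIT; exact: PrE. Qed.

Lemma count_indic_measurable (I : finType) (J : {set I}) (A : I -> set T) :
  (forall i, measurable (A i)) -> measurable_fun setT (fun w => \sum_(i in J) \1_(A i) w : R).
Proof.
move=> mA; under eq_fun do rewrite -big_enum.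
by apply: measurable_sum => i; exact: measurable_indic.
Qed.

(** Pairwise independence suffices: the variance of the count is [#|J|%:R * (p - p ^+ 2)], at most
    the mean. *)
Lemma chebyshev_count (I : finType) (J : {set I}) (A : I -> set T) (p a : R) :
  (forall i, measurable (A i)) -> (forall i, i \in J -> Pr (A i) = p) ->
  (forall i j, i \in J -> j \in J -> i != j -> Pr (A i `&` A j) = p ^+ 2) -> 0 < a ->
  Pr [set w | a <= `|\sum_(i in J) \1_(A i) w - #|J|%:R * p|] <= #|J|%:R * p / a ^+ 2.
Proof.
move=> mA hA hAA a0.
pose N w : R := \sum_(i in J) \1_(A i) w; pose m : R := #|J|%:R * p.
have mN : measurable_fun setT N by exact: count_indic_measurable.
have N0 w : 0 <= N w by apply: sumr_ge0 => i _; rewrite indicE.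
have mD : measurable_fun setT (fun w => (N w - m) ^+ 2).
  by apply: measurable_funX; apply: measurable_funB.
have m0 : 0 <= m.
  by rewrite /m; have [->|[i Ji]] := set_0Vmem J; rewrite ?cards0 ?mul0r// mulr_ge0// -(hA i)// Pr_ge0.

have EN : (\int[P]_w (N w)%:E)%E = m%:E.
  under eq_integral do rewrite /N -sumEFin -big_enum.
  have mE i : measurable_fun setT (fun w => (\1_(A i) w : R)%:E).
    by apply/measurable_EFinP; exact: measurable_indic.
  have E0 i w : setT w -> (0 <= (\1_(A i) w : R)%:E)%E by rewrite lee_fin indicE.
  rewrite (ge0_integral_sum _ measurableT mE E0).
  rewrite big_enum; under eq_bigr => i Ji do rewrite integral_indic_Pr// hA//.
  by rewrite sumEFin sumr_const /m mulr_natl.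
(* The square is a double sum of indicators of intersections: diagonal terms have probability [p],
   the others [p ^+ 2]. *)
have EN2 : (\int[P]_w (N w ^+ 2)%:E)%E = (m + #|J|%:R * (#|J|%:R - 1) * p ^+ 2)%:E.
  have N2 w : (N w ^+ 2)%:E = (\sum_(i <- enum J) \sum_(j <- enum J) (\1_(A i `&` A j) w)%:E)%E.
    rewrite big_enum/=; under eq_bigr do rewrite big_enum/=.
    rewrite expr2 /N big_distrlr/= -sumEFin; apply: eq_bigr => i _.
    by rewrite -sumEFin; apply: eq_bigr => j _; rewrite indicI.
  under eq_integral do rewrite N2.
  have mI i j : measurable (A i `&` A j) by exact: measurableI.
  have mEI i j : measurable_fun setT (fun w => (\1_(A i `&` A j) w : R)%:E).
    by apply/measurable_EFinP; exact: measurable_indic.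
  have EI0 i j w : setT w -> (0 <= (\1_(A i `&` A j) w : R)%:E)%E by rewrite lee_fin indicE.
  have mEs i : measurable_fun setT (fun w => \sum_(j <- enum J) (\1_(A i `&` A j) w : R)%:E)%E.
    exact: emeasurable_sum.
  have Es0 i w : setT w -> (0 <= \sum_(j <- enum J) (\1_(A i `&` A j) w : R)%:E)%E.
    by move=> _; apply: sume_ge0 => j _; exact: EI0.
  rewrite (ge0_integral_sum _ measurableT mEs Es0).
  rewrite big_enum/= (eq_bigr (fun=> (p + (#|J|%:R - 1) * p ^+ 2)%:E)); last first.
    move=> i Ji; rewrite (ge0_integral_sum _ measurableT (mEI i) (EI0 i)) big_enum/=.
    under eq_bigr => j Jj do rewrite integral_indic_Pr//.
    rewrite sumEFin (bigD1 i)//= setIid hA//; congr (_ + _)%:E.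
    rewrite (eq_bigr (fun=> p ^+ 2)); last by move=> j /andP[Jj ji]; rewrite hAA// eq_sym.
    rewrite sumr_const -[LHS]mulr_natl (cardsD1 i J) Ji natrD [1%:R + _]addrC addrK.
    congr (_%:R * _).
    by apply: eq_card => j; rewrite !inE andbC.
  by rewrite sumEFin sumr_const /m; congr (_%:E); rewrite -[LHS]mulr_natl; ring.
have mE2 : (\int[P]_w ((N w - m) ^+ 2)%:E)%E = (m - #|J|%:R * p ^+ 2)%:E.
  (* The variance identity is arranged so that every integrand is nonnegative, and additivity needs
     no integrability. *)
  have : (\int[P]_w ((N w - m) ^+ 2)%:E + (2 * m)%:E * \int[P]_w (N w)%:E =
          \int[P]_w (N w ^+ 2)%:E + (m ^+ 2)%:E)%E.
    have mNE : measurable_fun setT (fun w => (N w)%:E) by exact/measurable_EFinP.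
    have N0E w : setT w -> (0 <= (N w)%:E)%E by rewrite lee_fin.
    have m20 : (0 <= (2 * m)%:E)%E by rewrite lee_fin mulr_ge0.
    rewrite -(ge0_integralZl _ measurableT mNE N0E m20).
    have mDE : measurable_fun setT (fun w => ((N w - m) ^+ 2)%:E) by exact/measurable_EFinP.
    have D0E w : setT w -> (0 <= ((N w - m) ^+ 2)%:E)%E by rewrite lee_fin sqr_ge0.
    have mZE : measurable_fun setT (fun w => (2 * m)%:E * (N w)%:E)%E by exact: measurable_funeM.
    have Z0E w : setT w -> (0 <= (2 * m)%:E * (N w)%:E)%E.
      by move=> _; rewrite mule_ge0// lee_fin.
    rewrite -(ge0_integralD _ measurableT D0E mDE Z0E mZE).
    have -> : (m ^+ 2)%:E = (\int[P]_w (m ^+ 2)%:E)%E.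
      by rewrite integral_cst// [X in (_ * X)%E](_ : _ = 1%E) ?mule1//; exact: probability_setT.
    have mSE : measurable_fun setT (fun w => (N w ^+ 2)%:E).
      by apply/measurable_EFinP; exact: measurable_funX.
    have S0E w : setT w -> (0 <= (N w ^+ 2)%:E)%E by rewrite lee_fin sqr_ge0.
    have c0E (w : T) : setT w -> (0 <= (m ^+ 2)%:E)%E by rewrite lee_fin sqr_ge0.
    rewrite -(ge0_integralD _ measurableT S0E mSE c0E (measurable_cst _)).
    by apply: eq_integral => w _; rewrite -EFinM -!EFinD; congr (_%:E); ring.
  rewrite EN EN2 -!EFinM -!EFinD.
  case: integral => [r|//|//]; rewrite -EFinD => -[] h; congr (_%:E).
  by move: h; rewrite /m => h; lra.
set B := [set w | _].
have mB : measurable B.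
  rewrite (_ : B = (fun w => `|N w - m|) @^-1` `[a, +oo[); last first.
    by apply/seteqP; split => w; rewrite /B/= in_itv/= andbT.
  rewrite -[X in measurable X]setTI; apply: measurableT_comp => //.
  by apply: measurable_funB.
rewrite ler_pdivlMr ?exprn_gt0// -lee_fin EFinM -PrE// muleC.
rewrite -integral_cst//.
(* Markov's inequality: the squared deviation is at least [a ^+ 2] on [B]. *)
apply: (@le_trans _ _ (\int[P]_(w in B) ((N w - m) ^+ 2)%:E)%E).
  apply: ge0_le_integral => //.
  - by move=> w _; rewrite lee_fin sqr_ge0.
  - by apply/measurable_EFinP; exact: measurable_funTS.
  - by move=> w Bw; rewrite lee_fin -[leRHS]real_normK ?num_real// lerXn2r ?nnegrE ?(ltW a0) ?normr_ge0.
apply: (@le_trans _ _ (\int[P]_w ((N w - m) ^+ 2)%:E)%E).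
  apply: ge0_subset_integral => //; first exact/measurable_EFinP.
  by move=> w _; rewrite lee_fin sqr_ge0.
by rewrite mE2 lee_fin gerBl mulr_ge0// sqr_ge0.
Qed.

End RealProbability.

(** The factorization through a real power of the square also holds at [0], where both sides are
    [0]. *)
Lemma measurable_invr (R : realType) : measurable_fun setT (@GRing.inv R).
Proof.
rewrite (_ : @GRing.inv R = fun x : R => x * (x ^+ 2) `^ (-1)).
  apply: measurable_funM => //.
  by apply: (measurableT_comp (measurable_powR (-1))); exact: measurable_funX.
apply/funext => x; rewrite powR_inv1 ?sqr_ge0//.
have [->|x0] := eqVneq x 0; first by rewrite invr0 mul0r.
by rewrite expr2 invfM mulrA divff// mul1r.
Qed.

(** * One model of size [n]: exceedance counts, rejections and measurability *)

Section FixedModel.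
Context (R : realType) d (T : measurableType d) (P : probability T R).
Variables (nu alpha : R) (n : nat) (Tn : {set 'I_n}) (X : 'I_n -> T -> R) (S : T -> R).
Hypothesis alpha01 : 0 < alpha <= 1 / 2.
Hypothesis tS : symmetric_density (t_kernel nu).
Hypothesis model : model_n P nu Tn X S.
Let gS : symmetric_density (@gauss_kernel R) := gauss_symmetric R.
Let alpha0 : 0 < alpha. Proof. by case/andP: alpha01. Qed.
Local Notation Pr := (Pr P).
Local Notation F := (F_t nu).
Local Notation p := (pval nu Tn X S).

Let mX i : measurable_fun setT (X i). Proof. by case: model. Qed.
Let mS : measurable_fun setT S. Proof. by case: model => _ []. Qed.

Definition exceed (c : R) (i : 'I_n) : set T := [set w | c < X i w].
Definition count_exceed (c : R) (w : T) : R := \sum_(i in Tn) \1_(exceed c i) w.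

Lemma measurable_exceed c i : measurable (exceed c i).
Proof.
rewrite (_ : exceed c i = X i @^-1` `]c, +oo[).
  by rewrite -[X in measurable X]setTI; exact: mX.
by apply/seteqP; split => w; rewrite /exceed/= in_itv/= andbT.
Qed.

Lemma count_exceedE c w : count_exceed c w = #|[set i in Tn | c < X i w]|%:R.
Proof.
rewrite /count_exceed -sum1_card natr_sum (eq_bigl (fun i => (i \in Tn) && (c < X i w))).
  rewrite [RHS]big_mkcondr/=; apply: eq_bigr => i _; rewrite indicE.
  by case: ifPn => h; [rewrite mem_set|rewrite memNset//=; exact/negP].
by move=> i; rewrite inE.
Qed.

Lemma Pr_exceed c i : i \in Tn -> Pr (exceed c i) = Phi (- c).
Proof.
move=> iT; have [_ [_ [XP _]]] := model.
have -> : exceed c i = ~` (X i @^-1` `]-oo, c]).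
  by apply/seteqP; split => w; rewrite /exceed/= in_itv/= ltNge => /negP.
rewrite Pr_setC; last by rewrite -[X in measurable X]setTI; exact: mX.
by rewrite /Pr XP//= Phi_oppE.
Qed.

(** Joint independence is specialized by leaving every coordinate except [i] and [j]
    unconstrained. *)
Lemma Pr_exceed2 c i j : i \in Tn -> j \in Tn -> i != j ->
  Pr (exceed c i `&` exceed c j) = Phi (- c) ^+ 2.
Proof.
move=> iT jT ij; have [_ [_ [_ [_ [_ ind]]]]] := model.
pose B (k : 'I_n) : set R := if (k == i) || (k == j) then `]c, +oo[%classic else setT.
have Bi : B i = `]c, +oo[%classic by rewrite /B eqxx.
have Bj : B j = `]c, +oo[%classic by rewrite /B eqxx orbT.
have E k : X k @^-1` `]c, +oo[ = exceed c k.
  by apply/seteqP; split => w; rewrite /exceed/= in_itv/= andbT.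
have mB k : measurable (B k).
  by rewrite /B; case: ifP => _; [exact: measurable_itv|exact: measurableT].
have := ind B setT mB measurableT.
rewrite (bigD1 i)//= (bigD1 j)/=; last by rewrite jT eq_sym.
rewrite big1 => [|k /andP[/andP[kT ki] kj]]; last first.
  by rewrite /B (negPf ki) (negPf kj)/= preimage_setT probability_setT.
rewrite Bi Bj !E preimage_setT probability_setT/= !mulr1 -!/(Pr _) !Pr_exceed// -expr2 => <-.
congr Pr; apply/seteqP; split => w /=.
  move=> [wi wj]; split=> // k kT; rewrite /B; case: ifP => // /orP[] /eqP ->.
    by rewrite /= in_itv/= andbT.
  by rewrite /= in_itv/= andbT.
move=> [h _]; have := h j jT; have := h i iT; rewrite Bi Bj/= !in_itv/= !andbT.
by [].
Qed.

Lemma measurable_count_exceed c : measurable_fun setT (count_exceed c).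
Proof. by apply: count_indic_measurable => i; exact: measurable_exceed. Qed.

Lemma measurable_count_dev (a c m : R) :
  measurable [set w | a <= `|count_exceed c w - m|].
Proof.
rewrite (_ : [set w | _] = (fun w => `|count_exceed c w - m|) @^-1` `[a, +oo[); last first.
  by apply/seteqP; split => w; rewrite /= in_itv/= andbT.
rewrite -[X in measurable X]setTI; apply: measurableT_comp => //.
by apply: measurable_funB => //; exact: measurable_count_exceed.
Qed.

Lemma count_exceed_chebyshev (a c : R) : 0 < a ->
  Pr [set w | a <= `|count_exceed c w - #|Tn|%:R * Phi (- c)|] <= #|Tn|%:R * Phi (- c) / a ^+ 2.
Proof.
apply: chebyshev_count => [i|i|i j]; first exact: measurable_exceed.
  exact: Pr_exceed.
exact: Pr_exceed2.
Qed.

(** Half of [delta] pays for replacing [#|Tn|] by [n] in the mean, the other half is the Chebyshev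
    deviation, whence the factor [4]. *)
Lemma count_exceed_lln (delta c : R) : (0 < n)%N -> 0 < delta ->
  (1 - delta / 2) * n%:R <= #|Tn|%:R ->
  Pr [set w | delta * n%:R <= `|count_exceed c w - n%:R * Phi (- c)|] <= 4 / (delta ^+ 2 * n%:R).
Proof.
move=> n0 d0 hn.
have n0' : 0 < n%:R :> R by rewrite ltr0n.
have Tn_n : #|Tn|%:R <= n%:R :> R by rewrite ler_nat (leq_trans (max_card _)) ?card_ord.
have P0 : 0 < Phi (- c) by exact: Phi_gt0.
have P1 : Phi (- c) < 1 by exact: (sym_cdf_lt1 gS).
have dn : 0 < delta / 2 * n%:R by rewrite mulr_gt0// divr_gt0.
apply: (@le_trans _ _ (Pr [set w | delta / 2 * n%:R <= `|count_exceed c w - #|Tn|%:R * Phi (- c)|])).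
  apply: Pr_le; [exact: measurable_count_dev|exact: measurable_count_dev|].
  move=> w /= h.
  have : `|count_exceed c w - n%:R * Phi (- c)| <=
         `|count_exceed c w - #|Tn|%:R * Phi (- c)| + `|(n%:R - #|Tn|%:R) * Phi (- c)|.
    rewrite -[`|(_ - _) * _|]normrN; apply: le_trans (ler_normD _ _).
    by rewrite le_eqVlt; apply/orP; left; apply/eqP; congr `|_|; ring.
  have : `|(n%:R - #|Tn|%:R) * Phi (- c)| <= delta / 2 * n%:R.
    rewrite ger0_norm; last by rewrite mulr_ge0 ?subr_ge0// ltW.
    apply: (@le_trans _ _ (n%:R - #|Tn|%:R)); last by lra.
    by rewrite ler_piMr ?subr_ge0// ltW.
  lra.
apply: (le_trans (count_exceed_chebyshev _ dn)).
rewrite ler_pdivrMr ?exprn_gt0//.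
rewrite (_ : 4 / _ * _ = n%:R); last by field; rewrite !gt_eqF.
by apply: le_trans Tn_n; rewrite ler_piMr// ltW.
Qed.

Lemma pvalE i w : i \in Tn -> p w i = 1 - F (X i w / S w).
Proof. by move=> iT; rewrite /pval iT. Qed.

Lemma pval_le_tail i (u : R) w : 0 < S w ->
  (p w i <= F (- u)) = ((i \notin Tn) || (S w * u <= X i w)%R).
Proof.
move=> S0; have [iT|iT] := boolP (i \in Tn); last first.
  by rewrite /pval (negPf iT) ltW// F_t_gt0.
rewrite pvalE//= -[F (- u)]opprK -subr_ge0 opprK.
have := F_t_tail tS u => h.
rewrite (_ : _ - (1 - _) = F (X i w / S w) - F u); last by rewrite -h; ring.
by rewrite subr_ge0 (sym_cdf_le_iff tS) ler_pdivlMr// mulrC.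
Qed.

Lemma card_below_tail (u : R) w : 0 < S w ->
  #|below (p w) (F (- u))| = (#|~: Tn| + #|[set i in Tn | (S w * u <= X i w)%R]|)%N.
Proof.
move=> S0; rewrite -(cardsID Tn) addnC; congr (_ + _)%N; apply: eq_card => i;
  rewrite !inE pval_le_tail//; by case: (i \in Tn) => /=; rewrite ?andbT ?andbF.
Qed.

Lemma V_n_le_R_n w : (V_n alpha nu Tn X S w <= R_n alpha nu Tn X S w)%N.
Proof. by apply: subset_leq_card; exact: finset.subsetIl. Qed.

Lemma R_n_le_V_n w : (R_n alpha nu Tn X S w <= #|~: Tn| + V_n alpha nu Tn X S w)%N.
Proof.
rewrite /R_n -(cardsID Tn) addnC leq_add2r; apply: subset_leq_card.
by apply/fintype.subsetP => i; rewrite !inE => /andP[].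
Qed.

Lemma R_n_le w : (R_n alpha nu Tn X S w <= n)%N.
Proof. by rewrite (leq_trans (max_card _))// card_ord. Qed.

Lemma critical_param k : (0 < k <= n)%N ->
  exists2 u, 0 <= u & k%:R * alpha / n%:R = F (- u).
Proof.
move=> /andP[k0 kn]; have n0 : (0 < n)%N by exact: leq_trans kn.
apply: (tail_param_alpha alpha01 tS).
rewrite divr_gt0 ?mulr_gt0 ?ltr0n//= ler_pdivrMr ?ltr0n// mulrC.
by rewrite ler_pM2l// ler_nat.
Qed.

(** Fixed-point equation: counting the p-values below the critical value of [R_n] returns [R_n]. *)
Lemma R_n_tail (u : R) w : 0 < S w -> (0 < R_n alpha nu Tn X S w)%N ->
  (R_n alpha nu Tn X S w)%:R * alpha / n%:R = F (- u) ->
  R_n alpha nu Tn X S w = (#|~: Tn| + #|[set i in Tn | (S w * u <= X i w)%R]|)%N.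
Proof.
move=> S0 r0 ru; rewrite -card_below_tail// -ru.
by rewrite [LHS]/R_n (LSU_rejE alpha0 r0).
Qed.

Lemma V_n_tail (u : R) w : 0 < S w -> (0 < R_n alpha nu Tn X S w)%N ->
  (R_n alpha nu Tn X S w)%:R * alpha / n%:R = F (- u) ->
  V_n alpha nu Tn X S w = #|[set i in Tn | (S w * u <= X i w)%R]|.
Proof.
move=> S0 r0 ru; rewrite /V_n (LSU_rejE alpha0 r0) -/(R_n alpha nu Tn X S w) ru.
apply: eq_card => i; rewrite !inE pval_le_tail//.
by case: (i \in Tn); rewrite /= ?andbT ?andbF.
Qed.

(** If [K] p-values lie below [F (- v)] and this level is at most [K * alpha / n], the step-up rule
    rejects at least [K] hypotheses; all but at most [#|~: Tn|] of the rejected ones are true. *)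
Lemma V_n_ge (v : R) w : 0 < S w -> (0 < n)%N ->
  n%:R * F (- v) <= alpha * (#|~: Tn| + #|[set i in Tn | (S w * v <= X i w)%R]|)%:R ->
  (#|[set i in Tn | (S w * v <= X i w)%R]| <= V_n alpha nu Tn X S w)%N.
Proof.
move=> S0 n0; rewrite -card_below_tail//; set K := #|below _ _| => hK.
have K0 : (0 < K)%N.
  rewrite -(ltr_nat R) -(pmulr_rgt0 _ alpha0); apply: lt_le_trans hK.
  by rewrite mulr_gt0 ?ltr0n// F_t_gt0.
have Kn : (K <= n)%N by rewrite (leq_trans (max_card _))// card_ord.
have KR : (K <= R_n alpha nu Tn X S w)%N.
  apply: (leq_card_LSU_rej alpha0); first by rewrite K0.
  apply: below_le; rewrite ler_pdivlMr ?ltr0n// mulrC (le_trans hK)//.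
  by rewrite mulrC.
by have := leq_trans KR (R_n_le_V_n w); rewrite /K card_below_tail// leq_add2l.
Qed.

Lemma measurable_pval i : measurable_fun setT (fun w => p w i).
Proof.
rewrite /pval; case: (i \in Tn); last exact: measurable_cst.
apply: measurable_funB => //; apply: measurableT_comp.
  exact: (continuous_measurable_fun (sym_cdf_continuous tS)).
apply: measurable_funM => //; exact: (measurableT_comp (@measurable_invr R)).
Qed.

(** The event is a finite union, over the possible comparison patterns, of finite intersections of
    measurable events. *)
Lemma measurable_LSU_rej (Q : set {set 'I_n}) :
  measurable [set w | Q (LSU_rej alpha (p w))].
Proof.
pose b w : {ffun 'I_n.+1 * 'I_n -> bool} :=
  [ffun ji : 'I_n.+1 * 'I_n => p w ji.2 <= (ji.1 : nat)%:R * alpha / n%:R].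
have bE w w' : b w = b w' -> LSU_rej alpha (p w) = LSU_rej alpha (p w').
  move=> /ffunP bb; apply: eq_LSU_rej => j i jn.
  by have := bb (inord j, i); rewrite !ffunE/= inordK.
rewrite (_ : [set w | _] = \bigcup_(c in [set c | exists2 w, b w = c & Q (LSU_rej alpha (p w))])
   \bigcap_(ji in [set: 'I_n.+1 * 'I_n]) [set w | b w ji = c ji]).
  apply: fin_bigcup_measurable => [|c _]; first exact: finite_finset.
  apply: fin_bigcap_measurable => [|[j i] _]; first exact: finite_finset.
  have m : measurable [set w | p w i <= j%:R * alpha / n%:R].
    rewrite (_ : [set w | _] = (fun w => p w i) @^-1` `]-oo, j%:R * alpha / n%:R]).
      by rewrite -[X in measurable X]setTI; exact: measurable_pval.
    by apply/seteqP; split => w; rewrite /= in_itv.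
  case: (c (j, i)).
    rewrite (_ : [set w | _] = [set w | p w i <= j%:R * alpha / n%:R])//.
    by apply/seteqP; split => w /=; rewrite ffunE.
  rewrite (_ : [set w | _] = ~` [set w | p w i <= j%:R * alpha / n%:R]).
    exact: measurableC.
  by apply/seteqP; split => w /=; rewrite ffunE; [move=> ->|move/negP/negPf].
apply/seteqP; split => w /=.
- by move=> Qw; exists (b w) => //=; exists w.
- move=> [c [w' <- Qw'] h]; rewrite (bE w w')//.
  by apply/ffunP => ji; exact: h.
Qed.

End FixedModel.

(** * Asymptotics of the numbers of rejections *)

Lemma near_inv_le (R : realType) (C e : R) : 0 < e ->
  \forall n \near \oo, (0 < n)%N /\ C / n%:R <= e.
Proof.
move=> e0; exists (Num.truncn (`|C| / e)).+1 => // n /= hn.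
have n0 : (0 < n)%N by exact: leq_trans hn.
split=> //; rewrite ler_pdivrMr ?ltr0n//; apply: (le_trans (ler_norm C)).
rewrite mulrC -ler_pdivrMr// ltW//; apply: lt_le_trans (truncnS_gt _) _.
by rewrite ler_nat.
Qed.

Section Asymptotics.
Context (R : realType) d (T : measurableType d) (P : probability T R).
Variables (nu alpha : R) (Tn : forall n : nat, {set 'I_n}).
Variables (X : forall n : nat, 'I_n -> T -> R) (S : nat -> T -> R).
Hypothesis nu0 : 0 < nu.
Hypothesis alpha01 : 0 < alpha <= 1 / 2.
Hypothesis tS : symmetric_density (t_kernel nu).
Hypothesis model : forall n, model_n P nu (Tn n) (@X n) (S n).
Hypothesis Tn_ratio : #|Tn n|%:R / n%:R @[n --> \oo] --> (1 : R).
Let gS : symmetric_density (@gauss_kernel R) := gauss_symmetric R.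
Let alpha0 : 0 < alpha. Proof. by case/andP: alpha01. Qed.
Let alphah : alpha <= 1 / 2. Proof. by case/andP: alpha01. Qed.
Local Notation Pr := (Pr P).
Local Notation F := (F_t nu).
Local Notation gap := (gap nu alpha).
Local Notation V n w := (V_n alpha nu (Tn n) (@X n) (S n) w).
Local Notation R_ n w := (R_n alpha nu (Tn n) (@X n) (S n) w).

Lemma measurable_S_ge n (s : R) : measurable [set w | s <= S n w].
Proof.
have [_ [mS _]] := model n.
rewrite (_ : [set w | _] = S n @^-1` `[s, +oo[).
  by rewrite -[X in measurable X]setTI; exact: mS.
by apply/seteqP; split => w; rewrite /= in_itv/= andbT.
Qed.

Lemma measurable_S_le n (s : R) : measurable [set w | S n w <= s].
Proof.
have [_ [mS _]] := model n.
rewrite (_ : [set w | _] = S n @^-1` `]-oo, s]).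
  by rewrite -[X in measurable X]setTI; exact: mS.
by apply/seteqP; split => w; rewrite /= in_itv/=.
Qed.

Lemma measurable_S_gt0 n : measurable [set w | 0 < S n w].
Proof.
rewrite (_ : [set w | _] = ~` [set w | S n w <= 0]).
  by apply: measurableC; exact: measurable_S_le.
by apply/seteqP; split => w /=; rewrite ltNge => /negP.
Qed.

Lemma measurable_VR n (Q : nat -> nat -> Prop) : measurable [set w | Q (V n w) (R_ n w)].
Proof. exact: (measurable_LSU_rej alpha tS (model n) (fun A => Q #|A :&: Tn n| #|A|)). Qed.

Lemma Tn_near (e : R) : 0 < e ->
  \forall n \near \oo, (0 < n)%N /\ (1 - e) * n%:R <= #|Tn n|%:R.
Proof.
move=> e0; have /cvgrPdist_le /(_ _ e0) h := Tn_ratio.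
apply: filterS2 (@near_inv_le R 0 1 ltr01) h => n [n0 _] h; split=> //.
by rewrite -ler_pdivlMr ?ltr0n//; move: h; rewrite ler_norml => /andP[]; lra.
Qed.

Lemma card_setC_Tn n : #|~: Tn n|%:R = n%:R - #|Tn n|%:R :> R.
Proof. by apply/eqP; rewrite eq_sym subr_eq addrC -natrD cardsC card_ord. Qed.

Lemma card_Tn_le n : #|Tn n|%:R <= n%:R :> R.
Proof. by rewrite ler_nat (leq_trans (max_card _))// card_ord. Qed.

(** One-sided Glivenko-Cantelli bound: counts and [Phi (- c)] are both nonincreasing in [c], so
    controlling the counts at finitely many Gaussian quantiles is enough. *)
Lemma count_uniform_upper (delta : R) : 0 < delta -> exists B : nat -> set T,
  [/\ forall n, measurable (B n),
      forall e : R, 0 < e -> \forall n \near \oo, Pr (B n) <= e &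
      forall n w, ~ B n w -> forall c,
        #|[set i in Tn n | (c <= X i w)%R]|%:R <= n%:R * (Phi (- c) + delta)].
Proof.
move=> d0; have d20 : 0 < delta / 2 by rewrite divr_gt0.
(* Half of [delta] is spent on the grid spacing [1 / m], the other half on deviations at the grid
   points. *)
pose m := (Num.truncn (2 / delta)).+1.
have m0 : 0 < m%:R :> R by rewrite ltr0n.
have m1 : m%:R^-1 <= delta / 2.
  by rewrite invf_ple ?posrE// invf_div ltW// truncnS_gt.
pose c_ (k : nat) : R := - quantile (@Phi R) (k%:R / m%:R).
have cE k : (0 < k < m)%N -> Phi (- c_ k) = k%:R / m%:R.
  move=> /andP[k0 km]; have [|z hz] := sym_cdf_surj gS (u := k%:R / m%:R).
    by rewrite divr_gt0 ?ltr0n//= ltr_pdivrMr// mul1r ltr_nat.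
  by rewrite /c_ opprK -hz (quantile_cdf gS).
pose D n k := [set w | delta / 2 * n%:R <= `|count_exceed (Tn n) (@X n) (c_ k) w - n%:R * Phi (- c_ k)|].
have mD n k : measurable (D n k) by exact: (measurable_count_dev (model n)).
exists (fun n => \big[setU/set0]_(k < m) D n k); split.
- by move=> n; exact: bigsetU_measurable.
- move=> e e0.
  have d40 : 0 < delta / 2 / 2 by rewrite divr_gt0.
  apply: filterS2 (Tn_near d40) (near_inv_le (m%:R * (4 / (delta / 2) ^+ 2)) e0) => n [n0 h1] [_ h2].
  apply: le_trans h2; rewrite -mulrA; apply: Pr_bigcup_le => // k _.
  apply: (le_trans (count_exceed_lln (model n) (c_ k) n0 d20 h1)).
  by rewrite invfM mulrA.
- move=> n w nB c.
  have Phi0 : 0 < Phi (- c) by exact: Phi_gt0.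
  have Phi1 : Phi (- c) < 1 by exact: (sym_cdf_lt1 gS).
  pose j := Num.truncn (m%:R * Phi (- c)).
  have j1 : j%:R <= m%:R * Phi (- c) by rewrite truncn_le// mulr_ge0 ?ltW.
  have j2 : m%:R * Phi (- c) < j.+1%:R by exact: truncnS_gt.
  have jm : (j.+1 <= m)%N.
    rewrite -(ltr_nat R); apply: le_lt_trans j1 _.
    by rewrite -[ltRHS]mulr1 ltr_pM2l.
  have j3 : j.+1%:R / m%:R <= Phi (- c) + delta / 2.
    rewrite -natr1 mulrDl mul1r lerD//.
    by rewrite ler_pdivrMr// mulrC.
  have n0 : 0 <= n%:R :> R by [].
  (* In the top cell [Phi (- c) + delta] is at least [1], and the trivial bound by [n] does. *)
  move: jm; rewrite leq_eqVlt => /orP[/eqP jm|jm].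
    apply: (@le_trans _ _ n%:R).
      by rewrite ler_nat (leq_trans (max_card _))// card_ord.
    rewrite -[leLHS]mulr1 ler_wpM2l//.
    by move: j3; rewrite jm divff ?gt_eqF//; lra.
  have jE : Phi (- c_ j.+1) = j.+1%:R / m%:R by rewrite cE.
  (* The strict inequality turns the weak condition [c <= X i w] into a strict exceedance of the
     grid point. *)
  have cc : c_ j.+1 < c.
    by rewrite -ltrN2 -(sym_cdf_lt_iff gS) -/(Phi _) -/(Phi _) jE ltr_pdivlMr// mulrC.
  have nD : ~ D n j.+1 w.
    move=> Dw; apply: nB; rewrite -bigcup_mkord.
    by exists j.+1.
  have {nD} : `|count_exceed (Tn n) (@X n) (c_ j.+1) w - n%:R * Phi (- c_ j.+1)| < delta / 2 * n%:R.
    by rewrite ltNge; apply/negP.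
  rewrite ltr_norml jE => /andP[_ h].
  apply: (@le_trans _ _ (count_exceed (Tn n) (@X n) (c_ j.+1) w)).
    rewrite count_exceedE ler_nat; apply: subset_leq_card; apply/fintype.subsetP => i.
    by rewrite !inE => /andP[-> /=]; exact: lt_le_trans.
  have := ler_wpM2l n0 j3; lra.
Qed.

(** A proportion of rejections of at least [x] puts the fixed-point equation at some [u <= ux],
    where a gap bounded away from [0] contradicts the uniform bound on counts. *)
Lemma R_n_upper (x ux s : R) : 0 < x -> F (- ux) = alpha * x -> 0 < s -> 0 <= ux ->
  (forall v, 0 <= v <= ux -> gap s v < 0) -> forall e : R, 0 < e ->
  \forall n \near \oo, Pr [set w | s <= S n w /\ x * n%:R <= (R_ n w)%:R] <= e.
Proof.
move=> x0 Fux s0 ux0 hgap e e0.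
(* Compactness of [[0, ux]] makes the negativity of the gap uniform, with margin [g] after division
   by [alpha]. *)
have [z] := EVT_max ux0 (continuous_subspaceT (@gap_continuous _ _ alpha tS s)).
rewrite in_itv/= => zux zmax.
pose g := - gap s z / alpha.
have g0 : 0 < g by rewrite divr_gt0// oppr_gt0 hgap.
have g20 : 0 < g / 2 by rewrite divr_gt0.
have [B [mB PB hB]] := count_uniform_upper g20.
(* The margin [g] pays [g / 2] for the counts and [g / 4] for the false hypotheses, and [g / 4] is
   left over. *)
have g40 : 0 < g / 4 by rewrite divr_gt0.
apply: filterS2 (Tn_near g40) (PB e e0) => n [n0 h1] h2.
have n0' : 0 < n%:R :> R by rewrite ltr0n.
apply: le_trans h2; apply: Pr_le => //.
  apply: measurableI; first exact: measurable_S_ge.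
  exact: (@measurable_VR n (fun _ r => x * n%:R <= r%:R)).
move=> w /= [sS xR]; apply: contrapT => nB.
have Sw : 0 < S n w by exact: lt_le_trans sS.
have R0 : (0 < R_ n w)%N by rewrite -(ltr_nat R) (lt_le_trans _ xR)// mulr_gt0.
have Rn : (0 < R_ n w <= n)%N by rewrite R0 R_n_le.
have [u u0 uE] := critical_param alpha01 tS Rn.
have uux : u <= ux.
  rewrite -(tail_le tS) Fux -uE ler_pdivlMr//.
  by rewrite -mulrA [leRHS]mulrC ler_pM2l.
have := R_n_tail alpha01 tS (S := S n) Sw R0 uE.
move=> /(congr1 (fun k : nat => k%:R : R)); rewrite natrD card_setC_Tn => RE.
have := hB n w nB (S n w * u).
have PS : Phi (- (S n w * u)) <= Phi (- (s * u)).
  by apply: (sym_cdf_le gS); rewrite lerN2 ler_wpM2r.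
have : gap s u <= - g * alpha.
  by rewrite /g mulNr divfK ?gt_eqF// opprK; apply: zmax; rewrite in_itv/= u0.
rewrite {1}/gap -uE => h3 h4.
have h5 : Phi (- (s * u)) <= (R_ n w)%:R / n%:R - g.
  rewrite -(ler_pM2l alpha0); move: h3.
  by rewrite (_ : alpha * (_ / _ - _) = (R_ n w)%:R * alpha / n%:R - g * alpha); [lra|ring].
have : #|[set i in Tn n | (S n w * u <= X i w)%R]|%:R <= (R_ n w)%:R - g / 2 * n%:R.
  apply: (le_trans h4).
  apply: (@le_trans _ _ (n%:R * ((R_ n w)%:R / n%:R - g + g / 2))).
    by rewrite ler_pM2l// lerD2r (le_trans PS).
  rewrite le_eqVlt; apply/orP; left; apply/eqP; field; rewrite gt_eqF//.
have : 0 < g * n%:R by rewrite mulr_gt0.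
lra.
Qed.

(** When [S <= s], the count for the threshold [S * v] dominates the count for the deterministic
    [s * v], which concentrates around its mean. *)
Lemma V_n_lower (s v : R) : 0 < s -> 0 <= v -> 0 < gap s v -> forall e : R, 0 < e ->
  \forall n \near \oo,
    Pr [set w | (0 < S n w /\ S n w <= s) /\ ~ (n%:R * F (- v) < alpha * (V n w)%:R)] <= e.
Proof.
move=> s0 v0 gv e e0.
(* With this choice [alpha * (Phi (- (s * v)) - g) = F (- v)], so a deviation below [g * n] still
   leaves enough p-values below [F (- v)]. *)
pose g := gap s v / alpha.
have g0 : 0 < g by rewrite divr_gt0.
have g20 : 0 < g / 2 by rewrite divr_gt0.
apply: filterS2 (Tn_near g20) (near_inv_le (4 / g ^+ 2) e0) => n [n0 h1] [_ h2].
have n0' : 0 < n%:R :> R by rewrite ltr0n.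
apply: le_trans h2; rewrite -mulrA -invfM.
apply: le_trans (count_exceed_lln (model n) (s * v) n0 g0 h1).
apply: Pr_le.
- apply: measurableI.
    by apply: measurableI; [exact: measurable_S_gt0|exact: measurable_S_le].
  exact: (@measurable_VR n (fun k _ => ~ (n%:R * F (- v) < alpha * k%:R))).
- exact: (measurable_count_dev (model n)).
move=> w /= [[Sw Ss] nV]; rewrite leNgt; apply/negP => h; apply: nV.
pose N := #|[set i in Tn n | (S n w * v <= X i w)%R]|.
have cN : count_exceed (Tn n) (@X n) (s * v) w <= N%:R.
  rewrite count_exceedE ler_nat; apply: subset_leq_card; apply/fintype.subsetP => i.
  rewrite !inE => /andP[-> /= h']; apply: le_trans (ltW h').
  by rewrite ler_wpM2r.
have hN : n%:R * F (- v) < alpha * N%:R.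
  move: h; rewrite ltr_norml => /andP[h _].
  have h3 : n%:R * (Phi (- (s * v)) - g) < N%:R by lra.
  have : alpha * (n%:R * (Phi (- (s * v)) - g)) < alpha * N%:R by rewrite ltr_pM2l.
  rewrite (_ : alpha * _ = n%:R * F (- v))// /g /gap; field; rewrite gt_eqF//.
apply: (lt_le_trans hN); rewrite ler_pM2l// ler_nat.
apply: (V_n_ge alpha01 tS) => //; apply: (le_trans (ltW hN)).
by rewrite ler_pM2l// ler_nat leq_addl.
Qed.

(* If the rejection threshold [k alpha / n] tends to [0], a union bound over [k] suffices:
   at level [t] a conditional null p-value has probability [O(t ^+ 2)], so that
   Chebyshev's inequality bounds each of the [O(x n)] events by [O(1 / n)]. *)
Lemma V_n_proportion_upper (s eta : R) : 0 < s -> 0 < eta ->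
  (forall v, 0 <= v -> gap s v < 0) -> forall e : R, 0 < e ->
  \forall n \near \oo,
    Pr [set w | s <= S n w /\ eta * (maxn (R_ n w) 1)%:R < (V n w)%:R] <= e.
Proof.
move=> s0 eta0 hgap e e0.
(* Working at [s / 2] makes [S * u <= X] imply the strict exceedance of [s / 2 * u] whenever
   [S >= s] and [u > 0]. *)
have s20 : 0 < s / 2 by rewrite divr_gt0.
have [C C0 hC] := Phi_tail_le_sqr nu0 tS s20.
pose A := C * alpha ^+ 2.
have A0 : 0 < A by rewrite mulr_gt0// exprn_gt0.
(* The three bounds keep the levels below [1 / 2], hold the mean count below half of [eta * k], and
   make the union bound at most [e / 2]. *)
pose x := Num.min (1 / 2) (Num.min (eta / (2 * A)) (e * eta ^+ 2 / (8 * A))).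
have x0 : 0 < x.
  by rewrite !lt_min !divr_gt0 ?mulr_gt0 ?exprn_gt0.
have xh : x <= 1 / 2 by rewrite ge_min lexx.
have x1 : A * x <= eta / 2.
  rewrite mulrC -ler_pdivlMr// (_ : eta / 2 / A = eta / (2 * A)); last by field; rewrite gt_eqF.
  by rewrite !ge_min lexx orbT.
have x2 : x * (4 * A / eta ^+ 2) <= e / 2.
  rewrite -ler_pdivlMr ?divr_gt0 ?mulr_gt0 ?exprn_gt0//.
  rewrite (_ : e / 2 / _ = e * eta ^+ 2 / (8 * A)); last by field; rewrite !gt_eqF.
  by rewrite !ge_min lexx !orbT.
have [|ux ux0 xE] := tail_param_alpha alpha01 tS (t := alpha * x).
  by rewrite mulr_gt0//= ger_pMr//; lra.
have e20 : 0 < e / 2 by rewrite divr_gt0.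
have := R_n_upper x0 (esym xE) s0 ux0 (fun v hv => hgap v (proj1 (andP hv))) e20.
apply: filterS2 (@near_inv_le R 0 1 ltr01) => n [n0 _] h1.
have n0' : 0 < n%:R :> R by rewrite ltr0n.
pose K := Num.truncn (x * n%:R).
have Kx : K%:R <= x * n%:R by rewrite truncn_le// mulr_ge0 ?ltW.
have Kn : (K <= n)%N.
  by rewrite -(ler_nat R) (le_trans Kx)// ger_pMl//; lra.
(* The index [k] stands for [k.+1] rejections, since the union starts at [0]. *)
pose u_ k := quantile F (1 - k.+1%:R * alpha / n%:R).
pose D k := [set w | eta * k.+1%:R / 2 <= `|count_exceed (Tn n) (@X n) (s / 2 * u_ k) w
                        - #|Tn n|%:R * Phi (- (s / 2 * u_ k))|].
have mD k : measurable (D k) by exact: (measurable_count_dev (model n)).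
have uE k : (k < K)%N -> 0 < u_ k /\ k.+1%:R * alpha / n%:R = F (- u_ k).
  move=> kK; have kn : (0 < k.+1 <= n)%N by rewrite /= (leq_trans kK).
  have [u u0 uE] := critical_param alpha01 tS kn.
  rewrite /u_ uE (quantile_F_t tS); split=> //; apply: (tail_gt0 tS); rewrite -uE.
  rewrite ltr_pdivrMr//; apply: (@le_lt_trans _ _ (x * n%:R * alpha)).
    by rewrite ler_pM2r// (le_trans _ Kx)// ler_nat.
  rewrite -mulrA mulrCA mulrC ltr_pM2r//.
  apply: (@le_lt_trans _ _ (1 / 2 * alpha)); first by rewrite ler_pM2r.
  by have := alphah; lra.
have mean k : (k < K)%N ->
    #|Tn n|%:R * Phi (- (s / 2 * u_ k)) <= A * k.+1%:R ^+ 2 / n%:R.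
  move=> kK; have [u0 kE] := uE k kK.
  apply: (@le_trans _ _ (n%:R * (C * F (- u_ k) ^+ 2))).
    by apply: ler_pM => //; [exact/ltW/Phi_gt0|exact: card_Tn_le|exact/hC/ltW].
  by rewrite -kE le_eqVlt; apply/orP; left; apply/eqP; rewrite /A; field; rewrite gt_eqF.
have k1 k : 0 < k.+1%:R :> R by rewrite ltr0n.
have PD : Pr (\big[setU/set0]_(k < K) D k) <= e / 2.
  apply: (@le_trans _ _ (K%:R * (4 * A / eta ^+ 2 / n%:R))); last first.
    apply: le_trans x2; rewrite mulrA ler_pdivrMr// [leRHS]mulrAC ler_pM2r//.
    by rewrite divr_gt0 ?mulr_gt0 ?exprn_gt0.
  (* Mean and squared deviation both scale as [k.+1%:R ^+ 2], so the Chebyshev bound does not depend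
     on [k]. *)
  apply: Pr_bigcup_le => // k kK.
  have a0 : 0 < eta * k.+1%:R / 2 by rewrite divr_gt0 ?mulr_gt0.
  apply: (le_trans (count_exceed_chebyshev (model n) (s / 2 * u_ k) a0)).
  rewrite ler_pdivrMr ?exprn_gt0//; apply: (le_trans (mean k kK)).
  by rewrite le_eqVlt; apply/orP; left; apply/eqP; field; rewrite !gt_eqF.
have mR : measurable [set w | s <= S n w /\ x * n%:R <= (R_ n w)%:R].
  apply: measurableI; first exact: measurable_S_ge.
  exact: (@measurable_VR n (fun _ r => x * n%:R <= r%:R)).
have mU : measurable (\big[setU/set0]_(k < K) D k) by exact: bigsetU_measurable.
apply: (@le_trans _ _ (e / 2 + e / 2)); last by rewrite -splitr.
apply: le_trans (lerD h1 PD); apply: le_trans (Pr_setU _ mR mU).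
apply: Pr_le; [|exact: measurableU|].
  apply: measurableI; first exact: measurable_S_ge.
  exact: (@measurable_VR n (fun k r => eta * (maxn r 1)%:R < k%:R)).
move=> w /= [sS hV].
have [xR|Rx] := leP (x * n%:R) (R_ n w)%:R; [by left|right].
have Sw : 0 < S n w by exact: lt_le_trans sS.
have V0 : (0 < V n w)%N.
  by rewrite -(ltr_nat R); apply: le_lt_trans hV; rewrite mulr_ge0// ltW.
have R0 : (0 < R_ n w)%N by apply: leq_trans V0 (V_n_le_R_n _ _ _ _ _ _).
have RK : (R_ n w <= K)%N.
  by rewrite -ltnS -(ltr_nat R) (lt_trans Rx)// truncnS_gt.
rewrite -bigcup_mkord; exists (R_ n w).-1; rewrite /= ?prednK//.
have kK : ((R_ n w).-1 < K)%N by rewrite prednK.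
have [u0 kE] := uE _ kK.
have hm := mean _ kK.
move: kE hm; rewrite /D/= prednK// => kE hm.
have VE := V_n_tail alpha01 tS (S := S n) Sw R0 kE.
rewrite ler_normr; apply/orP; left.
have cV : (V n w)%:R <= count_exceed (Tn n) (@X n) (s / 2 * u_ (R_ n w).-1) w.
  rewrite count_exceedE VE ler_nat; apply: subset_leq_card; apply/fintype.subsetP => i.
  rewrite !inE => /andP[-> /=]; apply: lt_le_trans; rewrite ltr_pM2r//.
  by apply: lt_le_trans sS; lra.
have hV' : eta * (R_ n w)%:R < (V n w)%:R.
  by move: hV; rewrite (maxn_idPl R0).
have : A * (R_ n w)%:R ^+ 2 / n%:R <= eta / 2 * (R_ n w)%:R.
  rewrite ler_pdivrMr// expr2 mulrA mulrAC [leRHS]mulrAC ler_pM2r ?ltr0n//.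
  apply: (@le_trans _ _ (A * (x * n%:R))); first by rewrite ler_pM2l// ltW.
  by rewrite mulrA ler_pM2r.
lra.
Qed.

End Asymptotics.

(** * Expectations of variables with values in [[0, 1]] from their tail probabilities *)

Section LayerCake.
Context (R : realType) d (T : measurableType d) (P : probability T R).
Notation mu := (@lebesgue_measure R).

Definition tail (Y : T -> R) (r : R) : R := Pr P [set w | r < Y w].

Lemma measurable_tail_set (Y : T -> R) r : measurable_fun setT Y -> measurable [set w | r < Y w].
Proof.
move=> mY; rewrite (_ : [set w | _] = Y @^-1` `]r, +oo[).
  by rewrite -[X in measurable X]setTI; exact: mY.
by apply/seteqP; split => w; rewrite /= in_itv/= andbT.
Qed.

Lemma measurable_tail (Y : T -> R) : measurable_fun setT Y -> measurable_fun setT (tail Y).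
Proof.
move=> mY.
have h : measurable_fun setT (- tail Y).
  apply: nondecreasing_measurable => //.
  move=> r s rs; rewrite /= !fctE lerN2; apply: Pr_le; try exact: measurable_tail_set.
  by move=> w /=; exact: le_lt_trans.
rewrite (_ : tail Y = - (- tail Y)); last by apply/funext => r; rewrite !fctE opprK.
exact: measurableT_comp.
Qed.

Lemma tail_ge0_le1 (Y : T -> R) r : measurable_fun setT Y -> 0 <= tail Y r <= 1.
Proof. by move=> mY; rewrite Pr_ge0 Pr_le1//; exact: measurable_tail_set. Qed.

Lemma unit_integrable (D : set R) (f : R -> R) : measurable D -> (mu D < +oo)%E ->
  measurable_fun D f -> (forall x, D x -> 0 <= f x <= 1) -> mu.-integrable D (EFin \o f).
Proof.
move=> mD fD mf f01; apply: measurable_bounded_integrable => //.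
exists 1; split=> // M M1 x Dx /=; have /andP[f0 f1] := f01 x Dx.
by rewrite ger0_norm// (le_trans f1)// ltW.
Qed.

Lemma layer_cake (Y : T -> R) : measurable_fun setT Y -> (forall w, 0 <= Y w <= 1) ->
  \int[P]_w Y w = \int[mu]_(r in `[0, 1]) tail Y r.
Proof.
move=> mY Y01.
pose X := (mfun_Sub (mem_set mY) : {RV P >-> R}).
have X0 w : 0 <= X w by case/andP: (Y01 w).
have := ge0_expectation_ccdf X0; rewrite expectation_def => h.
rewrite /Rintegral; have -> : (\int[P]_w (Y w)%:E = \int[P]_w (X w)%:E)%E by [].
rewrite h; congr fine.
have cE r : ccdf X r = (tail Y r)%:E.
  rewrite /ccdf /distribution /pushforward /tail -PrE; last exact: measurable_tail_set.
  by congr (P _); apply/seteqP; split => w; rewrite /= in_itv/= andbT.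
transitivity (\int[mu]_(r in `[0%R, +oo[) (tail Y r)%:E)%E.
  by apply: eq_integral => r _; exact: cE.
have -> : `[0, 1]%classic = `[0, +oo[%classic `&` `[0, 1]%classic :> set R.
  apply/seteqP; split => r; rewrite /= !in_itv/= ?andbT; last by move=> [].
  by move=> /andP[-> ->].
rewrite integral_mkcondr; apply: eq_integral => r; rewrite inE/= in_itv/= andbT => r0.
rewrite patchE; case: ifPn => //; rewrite notin_setE/= in_itv/= r0/= => /negP; rewrite -ltNge => r1.
rewrite /tail (_ : [set w | _] = set0) ?/Pr ?measure0//.
apply/seteqP; split => // w /= rY; have /andP[_] := Y01 w.
by rewrite leNgt (lt_trans r1).
Qed.

(** Dominated convergence with the constant [1]; measurability and bounds of [h] are inherited from
    the pointwise limit, which also yields its integrability. *)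
Lemma unit_integral_cvg (a b : R) (f : nat -> R -> R) (h : R -> R) :
  (forall n, measurable_fun setT (f n)) -> (forall n x, 0 <= f n x <= 1) ->
  (forall x, a < x < b -> f n x @[n --> \oo] --> h x) ->
  \int[mu]_(x in `]a, b[) f n x @[n --> \oo] --> \int[mu]_(x in `]a, b[) h x /\
  mu.-integrable `]a, b[ (EFin \o h).
Proof.
move=> mf f01 fh.
have fin : (mu `]a, b[%classic < +oo)%E.
  by rewrite lebesgue_measure_itv/=; case: ifP => // _; rewrite -EFinB ltry.
have mh : measurable_fun `]a, b[ h.
  apply: (measurable_fun_cvg (h := f)) => [n|x]; first exact: measurable_funS (mf n).
  by rewrite /= in_itv; exact: fh.
have h01 x : `]a, b[%classic x -> 0 <= h x <= 1.
  rewrite /= in_itv/= => /fh hx; apply/andP; split.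
    by apply: (cvgr_to_ge hx); near=> n; case/andP: (f01 n x).
  by apply: (cvgr_to_le hx); near=> n; case/andP: (f01 n x).
have hi : mu.-integrable `]a, b[ (EFin \o h) by exact: unit_integrable.
split=> //; rewrite /Rintegral; apply: fine_cvg; rewrite fineK; last exact: integrable_fin_num.
apply: (@dominated_cvg _ _ _ _ _ _ _ _ (cst 1%E)) => //.
- by move=> n; apply/measurable_EFinP; exact: measurable_funS (mf n).
- move=> x; rewrite /= in_itv/= => /fh hx; apply/fine_cvgP; split; [exact: nearW|exact: hx].
- by apply: unit_integrable => //= x _; rewrite ler01 lexx.
- by move=> n x _ /=; have /andP[f0 f1] := f01 n x; rewrite lee_fin ger0_norm.
Unshelve. all: by end_near.
Qed.

Lemma unit_Rintegral_split (c : R) (f : R -> R) : 0 < c < 1 -> measurable_fun setT f ->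
  (forall x, 0 <= f x <= 1) ->
  \int[mu]_(x in `[0, 1]) f x = \int[mu]_(x in `]0, c[) f x + \int[mu]_(x in `]c, 1[) f x.
Proof.
move=> /andP[c0 c1] mf f01.
have fi (i : interval R) : [set` i] `<=` `[0, 1]%classic -> mu.-integrable [set` i] (EFin \o f).
  move=> si; have h : mu.-integrable `[0, 1] (EFin \o f).
    apply: unit_integrable => //.
      by rewrite lebesgue_measure_itv/= lte_fin ltr01 -EFinB ltry.
    exact: measurable_funS mf.
  by apply: integrableS h => //; exact: measurable_itv.
have fi01 : mu.-integrable [set` Interval (BLeft 0) (BRight 1)] (EFin \o f) by exact: fi.
have c0' : (BLeft 0 <= BRight c)%O by rewrite bnd_simp ltW.
have c1' : (BRight c <= BRight 1)%O by rewrite bnd_simp ltW.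
have h := Rintegral_itvB fi01 c0' c1'.
rewrite addrC Rintegral_itv_bndo_bndc; last first.
  by apply: fi => x; rewrite /= !in_itv/= => /andP[? ?]; apply/andP; split; lra.
rewrite -h Rintegral_itv_bndo_bndc; last first.
  by apply: fi => x; rewrite /= !in_itv/= => /andP[? ?]; apply/andP; split; lra.
rewrite Rintegral_itv_obnd_cbnd ?subrK//.
by apply: fi => x; rewrite /= !in_itv/= => /andP[? ?]; apply/andP; split; lra.
Qed.

(* The exceptional level [c] is where the limiting tail function may jump. *)
Lemma mean_cvg_of_tail (Y : nat -> T -> R) (h : R -> R) (c : R) : 0 < c < 1 ->
  (forall n, measurable_fun setT (Y n)) -> (forall n w, 0 <= Y n w <= 1) ->
  (forall x, 0 < x < 1 -> x != c -> tail (Y n) x @[n --> \oo] --> h x) ->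
  \int[P]_w Y n w @[n --> \oo] -->
    \int[mu]_(x in `]0, c[) h x + \int[mu]_(x in `]c, 1[) h x /\
  mu.-integrable `]c, 1[ (EFin \o h).
Proof.
move=> c01 mY Y01 hY; have /andP[c0 c1] := c01.
have mt n : measurable_fun setT (tail (Y n)) by exact: measurable_tail.
have t01 n x : 0 <= tail (Y n) x <= 1 by exact: tail_ge0_le1.
have h1 x : 0 < x < c -> tail (Y n) x @[n --> \oo] --> h x.
  by move=> /andP[x0 xc]; apply: hY; rewrite ?x0 ?lt_eqF//= (lt_trans xc).
have h2 x : c < x < 1 -> tail (Y n) x @[n --> \oo] --> h x.
  by move=> /andP[xc x1]; apply: hY; rewrite ?x1 ?gt_eqF//= ?andbT (lt_trans c0).
have [i1 _] := unit_integral_cvg mt t01 h1.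
have [i2 hi] := unit_integral_cvg mt t01 h2.
split=> //.
under eq_fun => n do rewrite layer_cake// (unit_Rintegral_split c01)//.
exact: cvgD.
Qed.

End LayerCake.

(** * The distribution of the scale [S] *)

Section ScaleLaw.
Context (R : realType) d (T : measurableType d) (P : probability T R).
Variables (nu : R) (Tn : forall n : nat, {set 'I_n}).
Variables (X : forall n : nat, 'I_n -> T -> R) (S : nat -> T -> R).
Hypothesis nu0 : 0 < nu.
Hypothesis model : forall n, model_n P nu (Tn n) (@X n) (S n).
Local Notation Pr := (Pr P).

Definition scale_cdf (s : R) : R := F_chi nu (Num.sqrt nu * s).

Lemma scale_cdfE (s : R) : 0 < s -> scale_cdf s = F_chisq nu (nu * s ^+ 2).
Proof.
by move=> s0; rewrite /scale_cdf /F_chi mulr_gt0 ?sqrtr_gt0// exprMn sqr_sqrtr ?ltW.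
Qed.

Lemma scale_cdf_le0 (s : R) : s <= 0 -> scale_cdf s = 0.
Proof.
by move=> s0; rewrite /scale_cdf /F_chi ltNge mulr_ge0_le0 ?sqrtr_ge0.
Qed.

Let mSle n s : measurable [set w | S n w <= s] := measurable_S_le model n s.

Lemma Pr_S_le0 n : Pr [set w | S n w <= 0] = 0.
Proof.
have [_ [_ [_ [S1 _]]]] := model n.
have -> : [set w | S n w <= 0] = ~` [set w | 0 < S n w].
  by apply/seteqP; split => w /=; rewrite leNgt => /negP.
by rewrite Pr_setC; [rewrite /Pr S1 subrr|exact: (measurable_S_gt0 model)].
Qed.

Let mchisq n x : measurable [set w | nu * S n w ^+ 2 <= x].
Proof.
have [_ [mS _]] := model n.
rewrite (_ : [set w | _] = (fun w => nu * S n w ^+ 2) @^-1` `]-oo, x]); last first.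
  by apply/seteqP; split => w; rewrite /= in_itv.
rewrite -[X in measurable X]setTI.
by apply: measurable_funM => //; exact: measurable_funX.
Qed.

Lemma Pr_chisq n x : Pr [set w | nu * S n w ^+ 2 <= x] = F_chisq nu x.
Proof. by have [_ [_ [_ [_ [h _]]]]] := model n; rewrite /Pr h. Qed.

(** The events [S n w <= s] and [nu * S n w ^+ 2 <= nu * s ^+ 2] agree where [S n w > 0], which is
    almost everywhere. *)
Lemma Pr_S_le n s : 0 < s -> Pr [set w | S n w <= s] = scale_cdf s.
Proof.
move=> s0; rewrite scale_cdfE// -(Pr_chisq n).
have E w : 0 < S n w -> (S n w <= s) = (nu * S n w ^+ 2 <= nu * s ^+ 2).
  by move=> Sw; rewrite ler_pM2l// ler_sqr// nnegrE; exact: ltW.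
have inc (A B : set T) : measurable A -> measurable B ->
    (forall w, 0 < S n w -> A w -> B w) -> Pr A <= Pr B.
  move=> mA mB AB; rewrite -[leRHS]addr0 -(Pr_S_le0 n).
  apply: le_trans (Pr_setU P mB (mSle n 0)); apply: Pr_le => //.
    exact: measurableU.
  by move=> w Aw /=; have [Sw|Sw] := leP (S n w) 0; [right|left; exact: AB].
apply/eqP; rewrite eq_le; apply/andP; split; apply: inc => // w Sw /=.
  by rewrite E.
by rewrite E.
Qed.

Lemma chisq_kernel_ge0 x : 0 <= chisq_kernel nu x.
Proof. by rewrite /chisq_kernel; case: ifP => // _; rewrite mulr_ge0 ?powR_ge0 ?expR_ge0. Qed.

Lemma measurable_chisq_kernel : measurable_fun setT (chisq_kernel nu).
Proof.
rewrite /chisq_kernel; apply: measurable_fun_ifT => //.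
- exact: measurable_fun_ltr.
- apply: measurable_funM; first exact: measurable_powR.
  apply: measurableT_comp => //; apply: measurable_funM => //.
Qed.

Lemma chisq_kernel_continuous (x : R) : 0 < x -> {for x, continuous (chisq_kernel nu)}.
Proof.
move=> x0.
have h : {for x, continuous (fun y : R => y `^ (nu / 2 - 1) * expR (- y / 2))}.
  have hp : {for x, continuous (fun y : R => y `^ (nu / 2 - 1))}.
    apply/differentiable_continuous/derivable1_diffP.
    by case: (is_derive1_powR (nu / 2 - 1) x0).
  apply: cvgM; first exact: hp.
  apply: continuous_comp; last exact: continuous_expR.
  by apply: cvgM; [apply: cvgN; exact: cvg_id|exact: cvg_cst].
rewrite /prop_for /continuous_at {2}/chisq_kernel x0.
apply: cvg_trans h; apply: near_eq_cvg; near=> y.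
by rewrite /chisq_kernel ifT//; near: y; exact: lt_nbhsr.
Unshelve. all: by end_near.
Qed.

(** A zero mass would make [F_chisq nu] vanish identically by division by [0]; then the events
    [nu * S ^+ 2 <= k] would be null although they exhaust the space. *)
Lemma chisq_mass_neq0 : dens_mass (chisq_kernel nu) != 0.
Proof.
apply/eqP => m0.
have F0 x : Pr [set w | nu * S 0%N w ^+ 2 <= x] = 0.
  by rewrite Pr_chisq /F_chisq /cdf_of m0 invr0 mulr0.
pose D (k : nat) := [set w | nu * S 0%N w ^+ 2 <= k%:R].
have mD k : measurable (D k) by exact: mchisq.
have D0 : P (\bigcup_k D k) = 0%E.
  apply/negligibleP; first exact: bigcup_measurable.
  apply: negligible_bigcup => k; apply/negligibleP => //.
  by have := PrE P (mD k); rewrite F0.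
have DT : \bigcup_k D k = setT.
  apply/seteqP; split => // w _; exists (Num.truncn (nu * S 0%N w ^+ 2)).+1 => //.
  by apply/ltW; exact: truncnS_gt.
by move: D0; rewrite DT probability_setT => /eqP; rewrite eqe oner_eq0.
Qed.

Lemma scale_cdf_continuous (s : R) : 0 < s -> {for s, continuous scale_cdf}.
Proof.
move=> s0.
have h : {for s, continuous (fun s : R => F_chisq nu (nu * s ^+ 2))}.
  apply: continuous_comp.
    by apply: cvgM; [exact: cvg_cst|exact: exprn_continuous].
  apply/differentiable_continuous/derivable1_diffP.
  have ns : 0 < nu * s ^+ 2 by rewrite mulr_gt0 ?exprn_gt0.
  by case: (cdf_of_is_derive chisq_kernel_ge0 measurable_chisq_kernel chisq_mass_neq0
    (chisq_kernel_continuous ns)).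
rewrite /prop_for /continuous_at scale_cdfE//.
apply: cvg_trans h; apply: near_eq_cvg; near=> y.
by rewrite scale_cdfE//; near: y; exact: lt_nbhsr.
Unshelve. all: by end_near.
Qed.

(** Right-continuity is also needed at [s <= 0], because the critical scale [s_one] can be
    nonpositive. *)
Lemma scale_cdf_above (s e : R) : 0 < e ->
  exists s', [/\ s < s', 0 < s' & scale_cdf s' <= scale_cdf s + e].
Proof.
move=> e0; have [s0|s0] := ltP 0 s.
  have /cvgrPdist_le /(_ _ e0) := scale_cdf_continuous s0.
  move=> /nbhs_ballP[r /= r0 hr].
  exists (s + r / 2); split; [by rewrite ltrDl divr_gt0|by rewrite addr_gt0// divr_gt0|].
  have : ball s r (s + r / 2).
    by rewrite /ball/= opprD addrA subrr sub0r normrN gtr0_norm ?divr_gt0//; lra.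
  by move=> /hr /=; rewrite ler_norml => /andP[]; lra.
rewrite (scale_cdf_le0 s0) add0r.
(* At nonpositive [s] continuity from above of [P] is used: the events [D k] decrease to the null
   event [S <= 0]. *)
pose D (k : nat) := [set w | S 0%N w <= k.+1%:R^-1].
have mD k : measurable (D k) by exact: mSle.
have ID : \bigcap_k D k = [set w | S 0%N w <= 0].
  apply/seteqP; split => w /=; last first.
    by move=> h k _; rewrite /D/= (le_trans h)// invr_ge0.
  move=> h; rewrite leNgt; apply/negP => Sw.
  have := h (Num.truncn (S 0%N w)^-1) I; rewrite /D/= => h'.
  have : (S 0%N w)^-1 < (Num.truncn (S 0%N w)^-1).+1%:R by exact: truncnS_gt.
  by rewrite invf_plt ?posrE// ltNge h'.
have Dfin : (P (D 0%N) < +oo)%E by rewrite (PrE P (mD _)) ltry.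
have Dni : {homo D : n m / (n <= m)%N >-> (m <= n)%O}.
  move=> n m nm; apply/subsetPset => w; rewrite /D/= => /le_trans; apply.
  by rewrite lef_pV2 ?posrE ?ltr0n// ler_nat ltnS.
have cvD : (P \o D) k @[k --> \oo] --> (0 : R)%:E.
  have <- : P (\bigcap_k D k) = (0 : R)%:E by rewrite ID (PrE P (mSle 0%N 0)) Pr_S_le0.
  by apply: nonincreasing_cvg_mu => //; rewrite ID; exact: mSle.
have /fine_cvg/cvgrPdist_le /(_ _ e0) [N _ /(_ N)/=] := cvD.
rewrite leqnn sub0r normrN => /(_ isT).
rewrite ger0_norm ?Pr_ge0// => hN.
exists N.+1%:R^-1; split; [by rewrite (le_lt_trans s0)// invr_gt0|by rewrite invr_gt0|].
by rewrite -(Pr_S_le 0%N) ?invr_gt0.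
Qed.

Lemma scale_cdf_below (s e : R) : 0 < s -> 0 < e ->
  exists s', [/\ 0 < s', s' < s & scale_cdf s - e <= scale_cdf s'].
Proof.
move=> s0 e0.
have /cvgrPdist_le /(_ _ e0) := scale_cdf_continuous s0.
move=> /nbhs_ballP[r /= r0 hr].
pose t := Num.min (r / 2) (s / 2).
have t0 : 0 < t by rewrite lt_min !divr_gt0.
have tr : t <= r / 2 by rewrite ge_min lexx.
have ts : t <= s / 2 by rewrite ge_min lexx orbT.
exists (s - t); split; [by lra|by lra|].
have : ball s r (s - t).
  by rewrite /ball/= subKr gtr0_norm//; lra.
by move=> /hr /=; rewrite ler_norml => /andP[]; lra.
Qed.

(* The events [A n] asymptotically coincide with [S n < sigma]. *)
Lemma Pr_cvg_scale_cdf (A : nat -> set T) (sigma : R) : (forall n, measurable (A n)) ->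
  (forall s, sigma < s -> 0 < s -> forall e : R, 0 < e ->
     \forall n \near \oo, Pr [set w | s <= S n w /\ A n w] <= e) ->
  (forall s, 0 < s -> s < sigma -> forall e : R, 0 < e ->
     \forall n \near \oo, Pr [set w | (0 < S n w /\ S n w <= s) /\ ~ A n w] <= e) ->
  Pr (A n) @[n --> \oo] --> scale_cdf sigma.
Proof.
move=> mA up low; apply/cvgrPdist_le => e e0.
have e20 : 0 < e / 2 by rewrite divr_gt0.
have hup : \forall n \near \oo, Pr (A n) <= scale_cdf sigma + e.
  have [s [ss s0 hs]] := scale_cdf_above sigma e20.
  apply: filterS (up s ss s0 _ e20) => n h.
  have mB : measurable [set w | s <= S n w /\ A n w].
    by apply: measurableI; [exact: (measurable_S_ge model)|exact: mA].
  have := Pr_setU P mB (mSle n s); rewrite (Pr_S_le n s0) => h'.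
  have : Pr (A n) <= Pr ([set w | s <= S n w /\ A n w] `|` [set w | S n w <= s]).
    apply: Pr_le => //; first exact: measurableU.
    by move=> w Aw /=; have [h1|h1] := leP s (S n w); [left|right; exact: ltW].
  by lra.
have hlow : \forall n \near \oo, scale_cdf sigma - e <= Pr (A n).
  have [s0|s0] := ltP 0 sigma; last first.
    by apply: nearW => n; rewrite (scale_cdf_le0 s0) sub0r (le_trans _ (Pr_ge0 P _))// oppr_le0 ltW.
  have [s [sp ss hs]] := scale_cdf_below s0 e20.
  apply: filterS (low s sp ss _ e20) => n h.
  pose B := [set w | (0 < S n w /\ S n w <= s) /\ ~ A n w].
  have mB : measurable B.
    apply: measurableI; last exact: measurableC.
    by apply: measurableI; [exact: (measurable_S_gt0 model)|exact: mSle].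
  have h1 := Pr_setU P (mA n) mB.
  have mAB : measurable (A n `|` B) by exact: measurableU.
  have h2 := Pr_setU P mAB (mSle n 0); rewrite Pr_S_le0 in h2.
  have : Pr [set w | S n w <= s] <= Pr (A n `|` B `|` [set w | S n w <= 0]).
    apply: Pr_le => //; first exact: measurableU.
    move=> w /= Sw; have [S0|S0] := leP (S n w) 0; first by right.
    by left; have [Aw|Aw] := pselect (A n w); [left|right].
  rewrite (Pr_S_le n sp) => h3; rewrite -/B in h; lra.
by apply: filterS2 hup hlow => n h1 h2; rewrite ler_norml; apply/andP; split; lra.
Qed.

End ScaleLaw.

(** * Limits of the error rates *)

Section Limits.
Context (R : realType) d (T : measurableType d) (P : probability T R).
Variables (nu alpha : R) (Tn : forall n : nat, {set 'I_n}).
Variables (X : forall n : nat, 'I_n -> T -> R) (S : nat -> T -> R).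
Hypothesis nu0 : 0 < nu.
Hypothesis alpha01 : 0 < alpha <= 1 / 2.
Hypothesis tS : symmetric_density (t_kernel nu).
Hypothesis model : forall n, model_n P nu (Tn n) (@X n) (S n).
Hypothesis Tn_ratio : #|Tn n|%:R / n%:R @[n --> \oo] --> (1 : R).
Variables (s0 u2 : R).
Hypotheses (s00 : 0 < s0) (u20 : 0 < u2).
Hypotheses (g0 : gap nu alpha s0 u2 = 0) (dg0 : dgap nu alpha s0 u2 = 0).
Let gS : symmetric_density (@gauss_kernel R) := gauss_symmetric R.
Let alpha0 : 0 < alpha. Proof. by case/andP: alpha01. Qed.
Let alphah : alpha <= 1 / 2. Proof. by case/andP: alpha01. Qed.
Local Notation Pr := (Pr P).
Local Notation F := (F_t nu).
Local Notation gap := (gap nu alpha).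
Local Notation V n w := (V_n alpha nu (Tn n) (@X n) (S n) w).
Local Notation R_ n w := (R_n alpha nu (Tn n) (@X n) (S n) w).
Local Notation scale_cdf := (scale_cdf nu).
Notation mu := (@lebesgue_measure R).

Let above (s v : R) : s0 < s -> 0 <= v -> gap s v < 0.
Proof. exact: (gap_lt0_above_tangent nu0 alpha01 tS s00 u20 g0 dg0). Qed.

Let mVR n (Q : nat -> nat -> Prop) : measurable [set w | Q (V n w) (R_ n w)].
Proof. exact: (measurable_VR alpha tS model). Qed.

Let V_le_R n w : (V n w)%:R <= (R_ n w)%:R :> R.
Proof. by rewrite ler_nat V_n_le_R_n. Qed.

Lemma measurable_fun_VR n (f : nat -> nat -> R) :
  measurable_fun setT (fun w => f (V n w) (R_ n w)).
Proof. by move=> _ Y mY; rewrite setTI; exact: (mVR n (fun k r => Y (f k r))). Qed.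

(** [sigma] is the critical scale. Above it the gap is negative on [[0, ux]], which keeps [R_n],
    hence [V_n], below [x * n]; below it the gap is positive at [v], whose level is at least
    [alpha * x]. *)
Lemma Pr_V_cvg (x sigma ux v : R) : 0 < x -> F (- ux) = alpha * x -> 0 <= ux ->
  (forall s : R, sigma < s -> 0 < s -> forall v : R, 0 <= v <= ux -> gap s v < 0) ->
  0 <= v -> alpha * x <= F (- v) -> (forall s : R, 0 < s -> s < sigma -> 0 < gap s v) ->
  Pr [set w | x < (V n w)%:R / n%:R] @[n --> \oo] --> scale_cdf sigma.
Proof.
move=> x0 Fux ux0 hup v0 xv hlow.
apply: (Pr_cvg_scale_cdf nu0 model) => [n|s ss sp e e0|s sp ss e e0].
- exact: (mVR n (fun k _ => x < k%:R / n%:R)).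
- have h := R_n_upper alpha01 tS model Tn_ratio x0 Fux sp ux0 (hup s ss sp) e0.
  apply: filterS2 (@near_inv_le R 0 1 ltr01) h => n [n0 _]; apply: le_trans.
  apply: Pr_le.
  + apply: measurableI; first exact: (measurable_S_ge model).
    exact: (mVR n (fun k _ => x < k%:R / n%:R)).
  + apply: measurableI; first exact: (measurable_S_ge model).
    exact: (mVR n (fun _ r => x * n%:R <= r%:R)).
  + move=> w /= [sS]; rewrite ltr_pdivlMr ?ltr0n// => h'; split=> //.
    by apply: le_trans (V_le_R n w); exact: ltW.
- have h := V_n_lower alpha01 tS model Tn_ratio sp v0 (hlow s sp ss) e0.
  apply: filterS2 (@near_inv_le R 0 1 ltr01) h => n [n0 _]; apply: le_trans.
  have n0' : 0 < n%:R :> R by rewrite ltr0n.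
  have mS' : measurable [set w | 0 < S n w /\ S n w <= s].
    by apply: measurableI; [exact: (measurable_S_gt0 model)|exact: (measurable_S_le model)].
  apply: Pr_le.
  + by apply: measurableI => //; exact: (mVR n (fun k _ => ~ (x < k%:R / n%:R))).
  + by apply: measurableI => //; exact: (mVR n (fun k _ => ~ (n%:R * F (- v) < alpha * k%:R))).
  + move=> w /= [hS nV]; split=> // hV; apply: nV.
    rewrite ltr_pdivlMr// -(ltr_pM2l alpha0); apply: le_lt_trans hV.
    by rewrite mulrA mulrC ler_pM2l.
Qed.

Lemma t2_lt : F (- u2) / alpha < 1 / 2.
Proof.
have /eqP := g0; rewrite subr_eq0 => /eqP <-.
rewrite mulrAC divff ?gt_eqF// -(sym_cdf0 gS) mul1r (sym_cdf_lt_iff gS).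
by rewrite oppr_lt0 mulr_gt0.
Qed.

(** Every scale below [s0] has a positive gap at [u2], whose level already exceeds [alpha * x];
    hence the limit does not depend on [x]. *)
Lemma Pr_V_cvg_low (x : R) : 0 < x < F (- u2) / alpha ->
  Pr [set w | x < (V n w)%:R / n%:R] @[n --> \oo] --> scale_cdf s0.
Proof.
move=> /andP[x0 x2]; have x1 := lt_trans x2 t2_lt.
have [|ux ux0 xE] := tail_param_alpha alpha01 tS (t := alpha * x).
  by rewrite mulr_gt0//= ger_pMr//; lra.
apply: (@Pr_V_cvg x s0 ux u2) => //.
- by move=> s ss _ v /andP[v0 _]; exact: above.
- exact: ltW.
- by rewrite mulrC -ler_pdivlMr// ltW.
- by move=> s _ ss; rewrite -g0 gap_lt_scale.
Qed.

(** The critical scale [z / u] solves [gap (z / u) u = 0]. For [x >= 1 / 2] it is nonpositive and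
    the limit is [0]. *)
Lemma Pr_V_cvg_high (x : R) : F (- u2) / alpha < x < 1 ->
  Pr [set w | x < (V n w)%:R / n%:R] @[n --> \oo] --> scale_cdf (s_one nu alpha (alpha * x)).
Proof.
move=> /andP[x2 x1].
have x0 : 0 < x by apply: lt_trans x2; rewrite divr_gt0// F_t_gt0.
have ax : alpha * x < 1 / 2 by apply: lt_le_trans alphah; rewrite gtr_pMr.
have [|u _ uE] := tail_param_alpha alpha01 tS (t := alpha * x).
  by rewrite mulr_gt0//= ger_pMr// ltW.
have u0 : 0 < u by apply: (tail_gt0 tS); rewrite -uE.
have [|y yE] := sym_cdf_surj gS (u := x); first by rewrite x0.
pose z := - y; have zE : Phi (- z) = x by rewrite /z opprK.
have sE : s_one nu alpha (alpha * x) = z / u.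
  by rewrite {1}uE; apply: s_one_tail => //; rewrite zE.
have gu : gap (z / u) u = 0 by rewrite /gap divfK ?gt_eqF// zE uE subrr.
have uu2 : u < u2 by rewrite -(tail_lt tS) -uE mulrC -ltr_pdivrMr.
rewrite sE; apply: (@Pr_V_cvg x (z / u) u u) => //.
- exact: ltW.
- move=> s ss sp v /andP[]; rewrite le_eqVlt => /predU1P[<- _|v0 vu]; first exact: gap0_lt0.
  (* Comparison with the truncated scale: at scale [0] the gap is [alpha / 2 - F (- v)], which is
     handled directly, while a positive [z / u] lies below [s0] and single crossing applies. *)
  apply: (@lt_le_trans _ _ (gap (Num.max 0 (z / u)) v)).
    by rewrite gap_lt_scale// gt_max sp.
  have [zu|zu] := leP (z / u) 0.
    rewrite /gap mul0r oppr0 /Phi (sym_cdf0 gS) subr_le0.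
    apply: (@le_trans _ _ (F (- u))); last by rewrite (tail_le tS).
    rewrite -uE ler_pM2l// -zE -(sym_cdf0 gS); apply: (sym_cdf_le gS).
    by move: zu; rewrite ler_pdivrMr// mul0r oppr_ge0.
  move: vu; rewrite le_eqVlt => /predU1P[->|vu]; first by rewrite gu.
  have ss0 : 0 < z / u < s0.
    by rewrite zu (scale_lt_tangent nu0 alpha01 tS s00 u20 g0 dg0 (ltW u0) _ gu)// lt_eqF.
  exact/ltW/(gap_lt0_before nu0 alpha01 tS u20 g0 ss0 gu (ltW uu2) (ltW v0) vu).
- exact: ltW.
- by rewrite uE.
- by move=> s _ ss; rewrite -gu gap_lt_scale.
Qed.

(** For [S < s0] the true rejections are of order [n] and outnumber the false hypotheses, so the
    ratio is near [1]; for [S > s0] it is near [0]. Hence the limit is the same for all [eta]. *)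
Lemma Pr_proportion_cvg (eta : R) : 0 < eta < 1 ->
  Pr [set w | eta < (V n w)%:R / (maxn (R_ n w) 1)%:R] @[n --> \oo] --> scale_cdf s0.
Proof.
move=> /andP[eta0 eta1].
have m0 n w : 0 < (maxn (R_ n w) 1)%:R :> R by rewrite ltr0n leq_max orbT.
apply: (Pr_cvg_scale_cdf nu0 model) => [n|s ss sp e e0|s sp ss e e0].
- exact: (mVR n (fun k r => eta < k%:R / (maxn r 1)%:R)).
- have h := V_n_proportion_upper nu0 alpha01 tS model Tn_ratio sp eta0 (fun v => @above s v ss) e0.
  apply: filterS h => n; apply: le_trans; apply: Pr_le.
  + apply: measurableI; first exact: (measurable_S_ge model).
    exact: (mVR n (fun k r => eta < k%:R / (maxn r 1)%:R)).
  + apply: measurableI; first exact: (measurable_S_ge model).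
    exact: (mVR n (fun k r => eta * (maxn r 1)%:R < k%:R)).
  + by move=> w /= [sS]; rewrite ltr_pdivlMr.
- have gu2 : 0 < gap s u2 by rewrite -g0 gap_lt_scale.
  have h := V_n_lower alpha01 tS model Tn_ratio sp (ltW u20) gu2 e0.
  pose y := F (- u2) / alpha.
  have y0 : 0 < y by rewrite divr_gt0// F_t_gt0.
  (* With at most [(1 - eta) * y * n] false hypotheses and [V_n > n * y], one gets
     [eta * (#|~: Tn| + V_n) < V_n]. *)
  have d0 : 0 < (1 - eta) * y by rewrite mulr_gt0// subr_gt0.
  apply: filterS2 (Tn_near Tn_ratio d0) h => n [n0 hn]; apply: le_trans.
  have n0' : 0 < n%:R :> R by rewrite ltr0n.
  have mS' : measurable [set w | 0 < S n w /\ S n w <= s].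
    by apply: measurableI; [exact: (measurable_S_gt0 model)|exact: (measurable_S_le model)].
  apply: Pr_le.
  + by apply: measurableI => //; exact: (mVR n (fun k r => ~ (eta < k%:R / (maxn r 1)%:R))).
  + by apply: measurableI => //; exact: (mVR n (fun k _ => ~ (n%:R * F (- u2) < alpha * k%:R))).
  + move=> w /= [hS nV]; split=> // hV; apply: nV.
    have Vy : n%:R * y < (V n w)%:R by rewrite /y mulrA ltr_pdivrMr// [ltRHS]mulrC.
    have V0 : (0 < V n w)%N by rewrite -(ltr_nat R); apply: lt_trans Vy; rewrite mulr_gt0.
    have R0 : (0 < R_ n w)%N by apply: leq_trans V0 (V_n_le_R_n _ _ _ _ _ _).
    rewrite ltr_pdivlMr// (maxn_idPl R0).
    have := R_n_le_V_n nu alpha (Tn n) (@X n) (S n) w.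
    rewrite -(ler_nat R) natrD card_setC_Tn => hR.
    have h1 : eta * (R_ n w)%:R <= eta * (n%:R - #|Tn n|%:R + (V n w)%:R).
      by rewrite ler_pM2l//; exact: hR.
    have h2 : eta * (n%:R - #|Tn n|%:R) <= 1 * (n%:R - #|Tn n|%:R).
      by apply: ler_wpM2r; [rewrite subr_ge0 card_Tn_le|exact: ltW].
    have h3 : (1 - eta) * (n%:R * y) < (1 - eta) * (V n w)%:R by rewrite ltr_pM2l// subr_gt0.
    lra.
Qed.

Lemma EER_cvg : EER_n P alpha nu (Tn n) (@X n) (S n) @[n --> \oo] -->
  F (- u2) * scale_cdf s0 / alpha +
  \int[mu]_(t in `[F (- u2) / alpha, 1]) scale_cdf (s_one nu alpha (alpha * t)).
Proof.
pose c := F (- u2) / alpha.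
have c01 : 0 < c < 1.
  by rewrite divr_gt0 ?F_t_gt0//=; have := t2_lt; rewrite -/c; lra.
(* Limiting tail of [V_n / n]: constant below the tangent proportion [c], governed by the crossing
   scale above it. *)
pose h x := if x < c then scale_cdf s0 else scale_cdf (s_one nu alpha (alpha * x)).
have mY n : measurable_fun setT (fun w => (V n w)%:R / n%:R : R).
  exact: (measurable_fun_VR n (fun k _ => k%:R / n%:R)).
have Y01 n w : 0 <= ((V n w)%:R / n%:R : R) <= 1.
  have [->|n0] := posnP n; first by rewrite invr0 mulr0 lexx ler01.
  rewrite divr_ge0//= ler_pdivrMr ?ltr0n// mul1r ler_nat.
  exact: leq_trans (V_n_le_R_n _ _ _ _ _ _) (R_n_le _ _ _ _ _ _).
have hY x : 0 < x < 1 -> x != c -> tail P (fun w => (V n w)%:R / n%:R) x @[n --> \oo] --> h x.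
  move=> /andP[x0 x1]; rewrite neq_lt /h => /orP[xc|cx].
    by rewrite xc; apply: Pr_V_cvg_low; rewrite x0.
  by rewrite ltNge (ltW cx)/=; apply: Pr_V_cvg_high; rewrite cx.
have [lim hi] := mean_cvg_of_tail c01 mY Y01 hY.
have -> : F (- u2) * scale_cdf s0 / alpha +
  \int[mu]_(t in `[F (- u2) / alpha, 1]) scale_cdf (s_one nu alpha (alpha * t)) =
  \int[mu]_(x in `]0, c[) h x + \int[mu]_(x in `]c, 1[) h x; last exact: lim.
congr (_ + _).
  rewrite (@eq_Rintegral _ _ _ _ _ (cst (scale_cdf s0))); last first.
    by move=> x; rewrite inE/= in_itv/= /h => /andP[_ ->].
  rewrite Rintegral_cst//= lebesgue_measure_itv/= lte_fin.
  by case/andP: c01 => -> _; rewrite -EFinB/= subr0 /c mulrA [scale_cdf s0 * _]mulrC.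
have E : {in `]c, 1[%classic, h =1 fun t => scale_cdf (s_one nu alpha (alpha * t))}.
  by move=> x; rewrite inE/= in_itv/= /h => /andP[cx _]; rewrite ltNge (ltW cx).
transitivity (\int[mu]_(x in `]c, 1[) scale_cdf (s_one nu alpha (alpha * x))); last first.
  by apply: eq_Rintegral => x xc; rewrite E.
have hi' : mu.-integrable `]c, 1[ (EFin \o (fun t => scale_cdf (s_one nu alpha (alpha * t)))).
  by apply: eq_integrable hi => //= x xc; rewrite E.
(* The endpoints are null; integrability of the limit provides the measurability needed to add
   them. *)
rewrite /Rintegral; congr fine.
by apply: (@integral_itv_bndoo R c 1 _ true false); case/integrableP: hi'.
Qed.

Lemma FDR_cvg : FDR_n P alpha nu (Tn n) (@X n) (S n) @[n --> \oo] --> scale_cdf s0.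
Proof.
(* The exceptional level is arbitrary here, as the limiting tail is constant on the unit
   interval. *)
have c01 : 0 < (1 / 2 : R) < 1 by apply/andP; split; lra.
have m0 n w : 0 < (maxn (R_ n w) 1)%:R :> R by rewrite ltr0n leq_max orbT.
have mY n : measurable_fun setT (fun w => (V n w)%:R / (maxn (R_ n w) 1)%:R : R).
  exact: (measurable_fun_VR n (fun k r => k%:R / (maxn r 1)%:R)).
have Y01 n w : 0 <= ((V n w)%:R / (maxn (R_ n w) 1)%:R : R) <= 1.
  rewrite divr_ge0//= ler_pdivrMr// mul1r ler_nat leq_max.
  by rewrite (V_n_le_R_n _ _ _ _ _ _).
have hY x : 0 < x < 1 -> x != 1 / 2 ->
    tail P (fun w => (V n w)%:R / (maxn (R_ n w) 1)%:R) x @[n --> \oo] --> cst (scale_cdf s0) x.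
  by move=> x01 _; exact: Pr_proportion_cvg.
have [lim _] := mean_cvg_of_tail c01 mY Y01 hY.
have -> : scale_cdf s0 = \int[mu]_(x in `]0, (1 / 2)%R[) cst (scale_cdf s0) x +
  \int[mu]_(x in `](1 / 2)%R, 1[) cst (scale_cdf s0) x; last exact: lim.
rewrite !Rintegral_cst//= !lebesgue_measure_itv/= !lte_fin.
case/andP: c01 => -> ->; rewrite -!EFinB/=; lra.
Qed.

End Limits.

(** * From the tangent point to the hypotheses on the gap, and conclusion *)

Lemma tangent_t_mass_neq0 (R : realType) (nu alpha t2 : R) : 0 < alpha ->
  is_tangent_point nu alpha t2 -> dens_mass (t_kernel nu) != 0.
Proof.
(* A zero mass would make [f_t nu] vanish identically, against the slope equation, whose Gaussian
   side is positive. Integrability of the Student kernel is thus read off the tangency. *)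
move=> a0 [_ [s s0 /= [_ h]]]; apply/eqP => m0; move: h => /eqP.
rewrite /f_t [X in _ == X]/pdf_of m0 invr0 mulr0 gt_eqF//.
by apply: mulr_gt0; [exact: mulr_gt0|exact: (sym_pdf_gt0 (gauss_symmetric R))].
Qed.

Lemma tangent_point_gap (R : realType) (nu alpha t2 : R) : 0 < alpha <= 1 / 2 ->
  symmetric_density (t_kernel nu) -> is_tangent_point nu alpha t2 ->
  exists s u : R, [/\ 0 < s, 0 < u, t2 = F_t nu (- u), gap nu alpha s u = 0 &
    dgap nu alpha s u = 0].
Proof.
move=> a01 tS [t2a [s s0]] /=.
have [u u0 tE] := tail_param_alpha a01 tS t2a.
rewrite tE (quantile_F_t tS) => -[h1 h2].
exists s, u; split=> //; last 2 first.
- by rewrite /gap h1 subrr.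
- by rewrite /dgap h2 subrr.
(* [u = 0] is impossible, because the gap is negative there for every scale. *)
move: u0; rewrite le_eqVlt => /orP[/eqP u0|//].
by have := gap0_lt0 a01 tS s; rewrite /gap; move: h1; rewrite -u0 => ->; rewrite subrr ltxx.
Qed.

Unset Implicit Arguments.
Theorem theorem4p2 (R : realType) (d : measure_display) (T : measurableType d)
  (P : probability T R) (nu alpha t2 : R)
  (n0 : nat -> nat) (Tn : forall n : nat, {set 'I_n})
  (X : forall n : nat, 'I_n -> T -> R) (S : nat -> T -> R) :
  0 < nu -> 0 < alpha <= 1 / 2 ->
  is_tangent_point nu alpha t2 ->
  (forall n, #|Tn n| = n0 n) ->
  ((n0 n)%:R / n%:R @[n --> \oo] --> (1 : R)) ->
  (forall n, model_n P nu (Tn n) (X n) (S n)) ->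
  [/\ C_one nu alpha = [set 0] `|` `]t2, alpha / 2[,
      EER_n P alpha nu (Tn n) (X n) (S n) @[n --> \oo] -->
        t2 * F_chi nu (Num.sqrt nu * s_one nu alpha t2) / alpha +
        \int[@lebesgue_measure R]_(t in `[t2 / alpha, 1])
          F_chi nu (Num.sqrt nu * s_one nu alpha (alpha * t)) &
      FDR_n P alpha nu (Tn n) (X n) (S n) @[n --> \oo] -->
        F_chi nu (Num.sqrt nu * s_one nu alpha t2)].
Proof.
move=> nu0 a01 ht n0E ratio model.
have a0 : 0 < alpha by case/andP: a01.
have tS := t_symmetric nu0 (tangent_t_mass_neq0 a0 ht).
have [s [u [s0 u0 tE gu dgu]]] := tangent_point_gap a01 tS ht.
have ratio' : #|Tn n|%:R / n%:R @[n --> \oo] --> (1 : R).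
  by under eq_fun do rewrite n0E.
have h1 : alpha * Phi (- (s * u)) = F_t nu (- u) by apply/eqP; rewrite -subr_eq0 -/(gap nu alpha s u) gu.
(* The tangency scale is recovered from [t2] as the crossing scale, with Gaussian point [s * u]. *)
have sE : s_one nu alpha t2 = s.
  by rewrite tE (s_one_tail a01 tS h1) mulfK// gt_eqF.
rewrite sE tE; split.
- exact (C_one_tangent nu0 a01 tS s0 u0 gu dgu).
- exact (EER_cvg nu0 a01 tS model ratio' s0 u0 gu dgu).
- exact (FDR_cvg nu0 a01 tS model ratio' s0 u0 gu dgu).
Qed.
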